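(* Let $k\in\mathbb N_0$, $0<\alpha<1$ and $f\in\mathcal C^{k,\alpha}(\mathbb S^2)$. Then the DFS function $\tilde f$ of $f$ belongs to $\mathcal C^{k,\alpha}(\mathbb T^2)$, and $$|\tilde f|_{\mathcal C^{k,\alpha}(\mathbb T^2)}\le(k+3)!\,\|f\|_{\mathcal C^{k,\alpha}(\mathbb S^2)},\qquad \|\tilde f\|_{\mathcal C^{k,\alpha}(\mathbb T^2)}\le\tfrac74(k+3)!\,\|f\|_{\mathcal C^{k,\alpha}(\mathbb S^2)}.$$
   Context: Notation: $\|\cdot\|$ Euclidean norm; $B^d_k:=\{\beta\in\mathbb N_0^d: |\beta|=\sum_i\beta_i\le k\}$. Spaces on open $U\subset\mathbb R^d$: $\mathcal C(U)$ is the set of bounded uniformly continuous $f\colon U\to\mathbb C$; for $k\ge1$, $\mathcal C^k(U)$ consists of $f$ whose classical partial derivatives $D^\beta f$, $\beta\in B^d_k$, exist and lie in $\mathcal C(U)$, with $\|f\|_{\mathcal C^k(U)}=\sum_{\beta\in B^d_k}\sup_U|D^\beta f|$. For $0<\alpha<1$, $|f|_{\mathcal C^{k,\alpha}(U)}:=\sup\{|D^\beta f(x)-D^\beta f(y)|/\|x-y\|^\alpha: x\ne y\in U,\ |\beta|=k\}$, $\mathcal C^{k,\alpha}(U)=\{f\in\mathcal C^k(U): |f|_{\mathcal C^{k,\alpha}(U)}<\infty\}$ with $\|f\|_{\mathcal C^{k,\alpha}(U)}=\|f\|_{\mathcal C^k(U)}+|f|_{\mathcal C^{k,\alpha}(U)}$.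 Torus: $\mathbb T^2=\mathbb R^2/(2\pi\mathbb Z^2)$; functions identified with $2\pi$-biperiodic functions on $\mathbb R^2$; $\mathcal C^{k,\alpha}(\mathbb T^2)$ is the set of $2\pi$-biperiodic elements of $\mathcal C^{k,\alpha}(\mathbb R^2)$ with the same (semi)norms. Sphere: $\mathbb S^2=\{x\in\mathbb R^3:\|x\|=1\}$. For $f\colon\mathbb S^2\to\mathbb C$, a $\mathcal C^{k,\alpha}$-extension of $f$ is some $f^*\in\mathcal C^{k,\alpha}(U)$, $U\supset\mathbb S^2$ open, with $f^*|_{\mathbb S^2}=f$. Set $|f^*|^*_{\mathcal C^{k,\alpha}(\mathbb S^2)}:=\sum_{\beta\in B^3_k}\sup_{\xi\in\mathbb S^2}|D^\beta f^*(\xi)|+\sup\{|D^\beta f^*(\xi)-D^\beta f^*(\eta)|/\|\xi-\eta\|^\alpha:\ \xi\ne\eta\in\mathbb S^2,\ |\beta|=k\}$, $\|f\|_{\mathcal C^{k,\alpha}(\mathbb S^2)}:=\inf$ of $|f^*|^*_{\mathcal C^{k,\alpha}(\mathbb S^2)}$ over all $\mathcal C^{k,\alpha}$-extensions, and $\mathcal C^{k,\alpha}(\mathbb S^2)$ is the set of $f$ with finite norm. DFS: $\phi(\lambda,\theta)=(\cos\lambda\sin\theta,\sin\lambda\sin\theta,\cos\theta)$; the DFS function of $f$ is $\tilde f:=f\circ\phi\colon\mathbb T^2\to\mathbb C$. *)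

(* Defs.v *)
From Stdlib Require Import Reals.
From Coquelicot Require Import Coquelicot.
From mathcomp Require Import ssreflect ssrfun ssrbool eqtype ssrnat seq fintype finfun bigop.

Set Implicit Arguments.
Unset Strict Implicit.

Local Open Scope R_scope.

Definition pt (d : nat) := 'I_d -> R.

Definition enorm {d : nat} (x : pt d) : R :=
  sqrt (\big[Rplus/0%R]_(i < d) (x i ^ 2)%R).
Definition pdist {d : nat} (x y : pt d) : R := enorm (fun i => x i - y i).

Definition is_open_set {d : nat} (U : pt d -> Prop) : Prop :=
  forall x, U x -> exists r, 0 < r /\ forall y, pdist x y < r -> U y.

Definition bdd_unif_cont {d : nat} (U : pt d -> Prop) (g : pt d -> C) : Prop :=
  (exists M, forall x, U x -> Cmod (g x) <= M) /\
  (forall eps, 0 < eps -> exists delta, 0 < delta /\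
     forall x y, U x -> U y -> pdist x y < delta -> Cmod (Cminus (g x) (g y)) < eps).

Definition shift {d : nat} (x : pt d) (i : 'I_d) (t : R) : pt d :=
  fun j => if j == i then x j + t else x j.

Definition partial_ex {d : nat} (i : 'I_d) (g : pt d -> C) (x : pt d) : Prop :=
  ex_derive (fun t => fst (g (shift x i t))) 0 /\
  ex_derive (fun t => snd (g (shift x i t))) 0.
Definition partial {d : nat} (i : 'I_d) (g : pt d -> C) : pt d -> C :=
  fun x => (Derive (fun t => fst (g (shift x i t))) 0,
            Derive (fun t => snd (g (shift x i t))) 0).

Fixpoint Dl {d : nat} (l : seq 'I_d) (g : pt d -> C) : pt d -> C :=
  match l with
  | [::] => g
  | i :: l' => partial i (Dl l' g)
  end.
Fixpoint Dl_ex {d : nat} (U : pt d -> Prop) (l : seq 'I_d) (g : pt d -> C) : Prop :=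
  match l with
  | [::] => True
  | i :: l' => Dl_ex U l' g /\ forall x, U x -> partial_ex i (Dl l' g) x
  end.

(* multi-index beta : 'I_d -> nat;  D^beta = d_0^{b_0} ... d_{d-1}^{b_{d-1}} *)
Definition dirs {d : nat} (b : 'I_d -> nat) : seq 'I_d :=
  flatten [seq nseq (b i) i | i <- enum 'I_d].
Definition Dm {d : nat} (b : 'I_d -> nat) (g : pt d -> C) : pt d -> C := Dl (dirs b) g.
Definition mabs {d : nat} (b : 'I_d -> nat) : nat := \sum_(i < d) b i.

(* sup_{x in U} |h x|  (with sup of the empty set := 0) *)
Definition supC {d : nat} (U : pt d -> Prop) (h : pt d -> C) : Rbar :=
  Rbar_lub (fun v => v = Rbar.Finite 0 \/ exists x, U x /\ v = Rbar.Finite (Cmod (h x))).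

Definition Ck_mem (d k : nat) (U : pt d -> Prop) (g : pt d -> C) : Prop :=
  forall b : 'I_d -> nat, (mabs b <= k)%nat ->
    Dl_ex U (dirs b) g /\ bdd_unif_cont U (Dm b g).

(* sum over beta in B^d_k of sup_U |D^beta g|; B^d_k enumerated by
   {ffun 'I_d -> 'I_k.+1} restricted to |beta| <= k *)
Definition Ck_norm (d k : nat) (U : pt d -> Prop) (g : pt d -> C) : Rbar :=
  \big[Rbar_plus/Rbar.Finite 0]_(b : {ffun 'I_d -> 'I_k.+1} |
        (mabs (fun i => nat_of_ord (b i)) <= k)%nat)
     supC U (Dm (fun i => nat_of_ord (b i)) g).

Definition holder_semi (d k : nat) (alpha : R) (U : pt d -> Prop) (g : pt d -> C) : Rbar :=
  Rbar_lub (fun v => v = Rbar.Finite 0 \/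
    exists (b : 'I_d -> nat) (x y : pt d),
      mabs b = k /\ U x /\ U y /\ x <> y /\
      v = Rbar.Finite (Cmod (Cminus (Dm b g x) (Dm b g y)) / Rpower (pdist x y) alpha)).

Definition Cka_mem (d k : nat) (alpha : R) (U : pt d -> Prop) (g : pt d -> C) : Prop :=
  Ck_mem k U g /\ Rbar_lt (holder_semi k alpha U g) p_infty.
Definition Cka_norm (d k : nat) (alpha : R) (U : pt d -> Prop) (g : pt d -> C) : Rbar :=
  Rbar_plus (Ck_norm k U g) (holder_semi k alpha U g).

(* Torus: 2pi-biperiodic elements of C^{k,alpha}(R^2) *)
Definition setT_pt (d : nat) : pt d -> Prop := fun _ => True.
Arguments setT_pt d _ : clear implicits.
Definition torus_mem (k : nat) (alpha : R) (g : pt 2 -> C) : Prop :=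
  Cka_mem k alpha (setT_pt 2) g /\
  forall (x : pt 2) (i : 'I_2), g (shift x i (2 * PI)) = g x.

Definition sphere (xi : pt 3) : Prop := enorm xi = 1.

Definition is_extension (k : nat) (alpha : R) (f fs : pt 3 -> C) : Prop :=
  exists U : pt 3 -> Prop, is_open_set U /\ (forall xi, sphere xi -> U xi) /\
    Cka_mem k alpha U fs /\ (forall xi, sphere xi -> fs xi = f xi).

Definition star_norm (k : nat) (alpha : R) (fs : pt 3 -> C) : Rbar :=
  Rbar_plus (Ck_norm k sphere fs) (holder_semi k alpha sphere fs).

Definition sphere_norm (k : nat) (alpha : R) (f : pt 3 -> C) : Rbar :=
  Rbar_glb (fun v => exists fs, is_extension k alpha f fs /\ v = star_norm k alpha fs).

Definition sphere_mem (k : nat) (alpha : R) (f : pt 3 -> C) : Prop :=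
  Rbar_lt (sphere_norm k alpha f) p_infty.

(* DFS map phi(lambda, theta), lambda = first coordinate, theta = second *)
Definition phi (x : pt 2) : pt 3 :=
  fun i => match nat_of_ord i with
           | 0%nat => cos (x ord0) * sin (x ord_max)
           | 1%nat => sin (x ord0) * sin (x ord_max)
           | _ => cos (x ord_max)
           end.

Definition dfs (f : pt 3 -> C) : pt 2 -> C := fun x => f (phi x).

(* Main.v *)
Require Import Defs.
From Stdlib Require Import Reals Factorial Lra Classical_Prop FunctionalExtensionality.
From Coquelicot Require Import Coquelicot.
From mathcomp Require Import ssreflect ssrfun ssrbool eqtype ssrnat seq path fintype finfun bigop.

Set Implicit Arguments.
Unset Strict Implicit.

Local Open Scope R_scope.

(* By the chain rule, a derivative of order [n] of [f* o phi] is a sum of terms, each a product of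
   [m <= n] derivatives of components of [phi] with a derivative of [f*] of order [m]. A further
   differentiation replaces such a term by [m + 3] terms, so there are at most [(n + 2)! / 2] of
   them. Every factor is bounded by 1 and alpha-Hoelder with constant 2, the derivatives of [f*]
   of order [m < k] composed with [phi] are Lipschitz, and [phi] itself is nonexpansive; hence
   each term is bounded by the norm [N] of [f*] and alpha-Hoelder with constant [2 (k + 3) N].
   Summing [(|b| + 2)! / 2] over [|b| <= k] gives at most [3/4 (k + 3)!]. *)

(** Two obstacles shape the proof. The hypotheses speak only of partial derivatives, taken in one
    fixed order of the variables. A chain rule therefore has to be built from continuous partial
    derivatives, moving one coordinate at a time, and each new direction that it produces must be
    commuted into its sorted place by Schwarz's theorem. Moreover, [N] controls the derivatives of
    the extension on the sphere only, and segments between points of the sphere leave it, so no mean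
    value estimate is made in space. The Lipschitz bounds for the lower derivatives are obtained in
    the parameter plane instead, after composition with [phi], where axis-parallel paths are always
    available. The constants fit exactly: [(k + 2)! / 2] terms with Hoelder constant [2 (k + 3) N]
    each give [(k + 3)! N]. The infimum over extensions is taken only at the very end, every
    estimate being proved for one fixed extension. *)

(** * Mean value estimates on the line and Schwarz's theorem *)

Lemma mvt_origin (h dh : R -> R) (t : R) :
  (forall u, Rabs u <= Rabs t -> is_derive h u (dh u)) ->
  exists c, Rabs c <= Rabs t /\ h t - h 0 = t * dh c.
Proof.
move=> hd.
have bnd u : Rmin 0 t <= u <= Rmax 0 t -> Rabs u <= Rabs t.
  rewrite /Rmin /Rmax; case: Rle_dec => h0 hu.
    by rewrite !Rabs_pos_eq; lra.
  by rewrite !Rabs_left1; lra.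
have [||c [hc ->]] := @MVT_gen h 0 t dh.
- by move=> u hu; apply: hd; apply: bnd; lra.
- move=> u hu; apply: derivable_continuous_pt; apply: ex_derive_Reals_0.
  by exists (dh u); apply: hd; apply: bnd.
by exists c; split; [exact: bnd | ring].
Qed.

(** A weak inequality for difference quotients survives the limit. The centre [m] allows the
    derivative to be compared with a prescribed value, as Schwarz's theorem requires. *)
Lemma is_derive_quotient_bound (h : R -> R) (l m b r : R) :
  0 < r -> is_derive h 0 l ->
  (forall s, s <> 0 -> Rabs s < r -> Rabs ((h s - h 0) / s - m) <= b) ->
  Rabs (l - m) <= b.
Proof.
move=> r0 /is_derive_Reals hl hb.
apply: Rnot_lt_le => hlt.
have e0 : 0 < Rabs (l - m) - b by lra.
have [d hd] := hl _ e0.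
have d0 := cond_pos d.
pose s := Rmin d r / 2.
have m0 : 0 < Rmin d r by apply: Rmin_pos.
have md := Rmin_l d r; have mr := Rmin_r d r.
have s0 : 0 < s by rewrite /s; lra.
have sE : Rabs s = s by rewrite Rabs_pos_eq; lra.
have h1 := hd s ltac:(lra) ltac:(rewrite sE /s; lra).
rewrite Rplus_0_l in h1.
have h2 := hb s ltac:(lra) ltac:(rewrite sE /s; lra).
have := Rabs_triang (l - (h s - h 0) / s) ((h s - h 0) / s - m).
have -> : l - (h s - h 0) / s + ((h s - h 0) / s - m) = l - m by ring.
rewrite (Rabs_minus_sym l ((h s - h 0) / s)); lra.
Qed.

(* Peano's form of Schwarz's theorem: the mixed derivative in one order is only assumed
   to exist, the other order is part of the conclusion. *)
Lemma schwarz_peano (F Ft Fts : R -> R -> R) (Fs : R -> R) (r : R) :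
  0 < r ->
  (forall s t, Rabs s < r -> Rabs t < r -> is_derive (fun t => F s t) t (Ft s t)) ->
  (forall s t, Rabs s < r -> Rabs t < r -> is_derive (fun s => Ft s t) s (Fts s t)) ->
  (forall t, Rabs t < r -> is_derive (fun s => F s t) 0 (Fs t)) ->
  (forall eps, 0 < eps -> exists delta, 0 < delta /\ forall s t,
     Rabs s < delta -> Rabs t < delta -> Rabs (Fts s t - Fts 0 0) < eps) ->
  is_derive Fs 0 (Fts 0 0).
Proof.
move=> r0 hFt hFts hFs hc.
apply/is_derive_Reals => eps eps0.
(* The limit in [s] only yields a weak inequality; halving [eps] makes the final one strict. *)
have [d0 [d00 hd0]] := hc (eps / 2) ltac:(lra).
pose d := Rmin d0 r.
have dp : 0 < d by apply: Rmin_pos.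
have dd : d <= d0 by apply: Rmin_l.
have dr : d <= r by apply: Rmin_r.
have z0 : Rabs 0 < r by rewrite Rabs_R0.
exists (mkposreal d dp) => t t0 /= ht; rewrite Rplus_0_l.
have tp := Rabs_pos_lt _ t0.
have key : Rabs (Fs t - Fs 0 - t * Fts 0 0) <= Rabs t * (eps / 2).
  apply: (@is_derive_quotient_bound (fun s => F s t - F s 0) _ _ _ d) => //.
    apply: (@is_derive_minus R_AbsRing R_NormedModule); apply: hFs; lra.
  move=> s s0 hs.
  (* The mean value theorem in [t], then in [s], turns the double difference of [F] over the
     rectangle into [t * s * Fts sg tau]. *)
  have [tau [htau e1]] := @mvt_origin (fun u => F s u - F 0 u) (fun u => Ft s u - Ft 0 u) t
    ltac:(move=> u hu; apply: (@is_derive_minus R_AbsRing R_NormedModule); apply: hFt; lra).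
  have [sg [hsg e2]] := @mvt_origin (fun u => Ft u tau) (fun u => Fts u tau) s
    ltac:(move=> u hu; apply: hFts; lra).
  have -> : (F s t - F s 0 - (F 0 t - F 0 0)) / s - t * Fts 0 0 = t * (Fts sg tau - Fts 0 0).
    have -> : F s t - F s 0 - (F 0 t - F 0 0) = F s t - F 0 t - (F s 0 - F 0 0) by ring.
    by rewrite e1 e2; field.
  rewrite Rabs_mult; apply: Rmult_le_compat_l; first by lra.
  by apply: Rlt_le; apply: hd0; lra.
have -> : (Fs t - Fs 0) / t - Fts 0 0 = (Fs t - Fs 0 - t * Fts 0 0) / t by field.
rewrite /Rdiv Rabs_mult Rabs_inv.
apply: (Rmult_lt_reg_r (Rabs t)) => //.
rewrite Rmult_assoc Rinv_l; last by lra.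
nra.
Qed.

(** * Shifts along the axes, cubes and partial derivatives in [pt d] *)

Section Shift.
Variable d : nat.
Implicit Types (x y : pt d) (i j : 'I_d).

Lemma shift0 x i : shift x i 0 = x.
Proof. by apply: functional_extensionality => j; rewrite /shift; case: eqP => // _; ring. Qed.

Lemma shift_shift x i s t : shift (shift x i s) i t = shift x i (s + t).
Proof. by apply: functional_extensionality => j; rewrite /shift; case: eqP => // _; ring. Qed.

Lemma shiftC x i j s t : shift (shift x i s) j t = shift (shift x j t) i s.
Proof.
by apply: functional_extensionality => l; rewrite /shift; case: eqP; case: eqP => // _ _; ring.
Qed.

Lemma shift_diff x i t l : Rabs (shift x i t l - x l) <= Rabs t.
Proof.
rewrite /shift; case: eqP => _; first by rewrite Rplus_comm /Rminus Rplus_assoc Rplus_opp_r Rplus_0_r; lra.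
by rewrite Rminus_diag Rabs_R0; apply: Rabs_pos.
Qed.

(** Partial derivatives are derivatives at 0 with a moving base point; the mean value theorem needs
    a derivative at [s] along one fixed line. *)
Lemma is_derive_shift (g : pt d -> R) x i s l :
  is_derive (fun u => g (shift (shift x i s) i u)) 0 l <->
  is_derive (fun u => g (shift x i u)) s l.
Proof.
split=> h.
  have h1 : is_derive (fun v => g (shift (shift x i s) i (v - s))) s (scal 1 l).
    apply: (@is_derive_comp _ _ (fun u => g (shift (shift x i s) i u)) (fun v => v - s)).
      by rewrite Rminus_diag.
    by auto_derive; [|ring].
  rewrite /scal /= /mult /= Rmult_1_l in h1.
  apply: is_derive_ext h1 => u; rewrite shift_shift; congr (g (shift _ _ _)); ring.
have h1 : is_derive (fun v => g (shift x i (s + v))) 0 (scal 1 l).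
  apply: (@is_derive_comp _ _ (fun u => g (shift x i u)) (fun v => s + v)).
    by rewrite Rplus_0_r.
  by auto_derive; [|ring].
rewrite /scal /= /mult /= Rmult_1_l in h1.
by apply: is_derive_ext h1 => u; rewrite shift_shift.
Qed.

Lemma mvt_shift (g dg : pt d -> R) x i t :
  (forall s, Rabs s <= Rabs t ->
     is_derive (fun u => g (shift (shift x i s) i u)) 0 (dg (shift x i s))) ->
  exists c, Rabs c <= Rabs t /\ g (shift x i t) - g x = t * dg (shift x i c).
Proof.
move=> h.
have [c [hc e]] := @mvt_origin (fun u => g (shift x i u)) (fun u => dg (shift x i u)) t
  ltac:(by move=> u hu; apply/is_derive_shift; apply: h).
by exists c; split => //; rewrite -e shift0.
Qed.

Lemma enorm_ge0 x : 0 <= enorm x.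
Proof. exact: sqrt_pos. Qed.

Lemma pdist_ge0 x y : 0 <= pdist x y.
Proof. exact: enorm_ge0. Qed.

(** The crude factor [d + 1] is nonzero for every [d], so [box_pdist] can divide by it. It serves
    only to compare neighbourhoods and enters no constant of the result. *)
Lemma enorm_bound x r : 0 <= r -> (forall i, Rabs (x i) <= r) -> enorm x <= INR d.+1 * r.
Proof.
move=> r0 h.
have hd : 0 <= INR d by apply: pos_INR.
have hS : \big[Rplus/0%R]_(i < d) (x i ^ 2)%R <= INR d * r ^ 2.
  have -> : INR d * r ^ 2 = \big[Rplus/0%R]_(i < d) (r ^ 2)%R.
    rewrite big_const_ord; elim: (d) => [|n IH] /=; first by rewrite Rmult_0_l.
    by rewrite -IH -/(INR n.+1) S_INR /=; ring.
  apply: (big_ind2 (fun a b => a <= b)) => [|a b c e ha hb|i _]; [lra | lra |].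
  by apply: pow_maj_Rabs.
rewrite /enorm -[X in _ <= X]sqrt_Rsqr; last by rewrite S_INR; nra.
apply: sqrt_le_1_alt; apply: Rle_trans hS _.
rewrite /Rsqr S_INR; nra.
Qed.

Lemma coord_le_enorm x i : Rabs (x i) <= enorm x.
Proof.
rewrite -sqrt_Rsqr_abs; apply: sqrt_le_1_alt.
have : forall s : seq 'I_d, i \in s -> Rsqr (x i) <= \big[Rplus/0%R]_(j <- s) (x j ^ 2)%R.
  elim=> // j s IH; rewrite inE big_cons => /orP [/eqP <-|/IH h].
    suff : 0 <= \big[Rplus/0%R]_(j <- s) (x j ^ 2)%R by rewrite /Rsqr; lra.
    by apply: big_ind => [|a b ha hb|l _]; [lra | lra | exact: pow2_ge_0].
  by have := pow2_ge_0 (x j); lra.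
by move/(_ (index_enum 'I_d)); apply; rewrite mem_index_enum.
Qed.

Lemma pdist_gt0 x y : x <> y -> 0 < pdist x y.
Proof.
move=> xy; have [//|/esym h] := pdist_ge0 x y.
case: xy; apply: functional_extensionality => i.
have := coord_le_enorm (fun i => x i - y i) i; rewrite -/(pdist x y) h => h1.
have := Rabs_pos (x i - y i) => h2.
have := Rabs_eq_0 (x i - y i) ltac:(lra); lra.
Qed.

Lemma box_pdist x e : 0 < e -> exists r, 0 < r /\
  forall y, (forall i, Rabs (y i - x i) < r) -> pdist x y < e.
Proof.
move=> e0; have hd : 0 < INR d.+1 by apply: lt_0_INR; apply/ltP.
exists (e / INR d.+1 / 2); split.
  by apply: Rdiv_lt_0_compat; [apply: Rdiv_lt_0_compat|lra].
move=> y hy; have r0 : 0 < e / INR d.+1 by apply: Rdiv_lt_0_compat.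
apply: Rle_lt_trans (_ : INR d.+1 * (e / INR d.+1 / 2) < _).
  apply: enorm_bound; first lra.
  by move=> i; rewrite Rabs_minus_sym; apply: Rlt_le.
have -> : INR d.+1 * (e / INR d.+1 / 2) = e / 2 by field; lra.
lra.
Qed.

Lemma open_box (U : pt d -> Prop) x : is_open_set U -> U x ->
  exists r, 0 < r /\ forall y, (forall i, Rabs (y i - x i) < r) -> U y.
Proof.
move=> hU /hU [e [e0 he]]; have [r [r0 hr]] := box_pdist x e0.
by exists r; split => // y /hr /he.
Qed.

(** Cubes suit paths that change one coordinate at a time, and a single radius gives both membership
    in [U] and closeness of values. *)
Definition box_cont (U : pt d -> Prop) (g : pt d -> R) (x : pt d) : Prop :=
  forall eps, 0 < eps -> exists r, 0 < r /\
    forall y, (forall i, Rabs (y i - x i) < r) -> U y /\ Rabs (g y - g x) < eps.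

Lemma schwarz_shift (U : pt d -> Prop) (G Gi Gj Gji : pt d -> R) (i j : 'I_d) x :
  is_open_set U ->
  (forall y, U y -> is_derive (fun t => G (shift y i t)) 0 (Gi y)) ->
  (forall y, U y -> is_derive (fun t => G (shift y j t)) 0 (Gj y)) ->
  (forall y, U y -> is_derive (fun t => Gj (shift y i t)) 0 (Gji y)) ->
  U x -> box_cont U Gji x ->
  is_derive (fun t => Gi (shift x j t)) 0 (Gji x).
Proof.
move=> oU hi hj hji ux hc.
have [r [r0 hr]] := open_box oU ux.
pose P s t := shift (shift x i s) j t.
have near e s t : Rabs s < e / 2 -> Rabs t < e / 2 -> forall l, Rabs (P s t l - x l) < e.
  move=> hs ht l; have h1 := shift_diff (shift x i s) j t l.
  have h2 := shift_diff x i s l.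
  have := Rabs_triang (P s t l - shift x i s l) (shift x i s l - x l).
  have -> : P s t l - shift x i s l + (shift x i s l - x l) = P s t l - x l by ring.
  rewrite -/(P s t) in h1; lra.
have P00 : P 0 0 = x by rewrite /P !shift0.
rewrite -{2}P00.
apply: (@schwarz_peano (fun s t => G (P s t)) (fun s t => Gj (P s t)) (fun s t => Gji (P s t))
  (fun t => Gi (shift x j t)) (r / 2)); first lra.
- move=> s t hs ht; apply/is_derive_shift; apply: hj; apply: hr; exact: near.
- move=> s t hs ht.
  apply: (@is_derive_ext _ _ (fun u => Gj (shift (shift x j t) i u))).
    by move=> u; rewrite shiftC.
  have PE : P s t = shift (shift x j t) i s by rewrite /P shiftC.
  by apply/is_derive_shift; rewrite PE; apply: hji; rewrite -PE; apply: hr; exact: near.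
- move=> t ht; apply: (@is_derive_ext _ _ (fun u => G (shift (shift x j t) i u))).
    by move=> u; rewrite shiftC.
  have PE : P 0 t = shift x j t by rewrite /P shift0.
  apply: hi; rewrite -PE; apply: hr; apply: near => //.
  by rewrite Rabs_R0; lra.
- move=> eps eps0; have [e [e0 he]] := hc _ eps0.
  exists (e / 2); split; first lra.
  move=> s t hs ht; rewrite P00; apply (he (P s t)); exact: near.
Qed.

(** One leg of the chain rule. The base point [p t] moves with [t], so the derivative at [x] alone
    is not enough: the mean value theorem gives [D] at a nearby point, and continuity of [D] does
    the rest. *)
Lemma is_lim_shift_quotient (U : pt d -> Prop) (G D : pt d -> R) (j : 'I_d)
  (p : R -> pt d) (v : R -> R) (v' : R) x :
  (forall y, U y -> is_derive (fun t => G (shift y j t)) 0 (D y)) ->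
  box_cont U D x ->
  (forall l, is_lim (fun t => p t l) 0 (x l)) ->
  v 0 = 0 -> is_derive v 0 v' ->
  is_lim (fun t => (G (shift (p t) j (v t)) - G (p t)) / t) 0 (v' * D x).
Proof.
move=> hD hc hp v0 hv.
have hv1 : is_lim v 0 0.
  rewrite -{2}v0; apply: is_lim_continuity; apply: derivable_continuous_pt.
  by apply: ex_derive_Reals_0; exists v'.
(* [v t] may vanish arbitrarily close to 0; there the value [D x] keeps the limit of [Q], and the
   product with [v t / t] is 0 as it should be. *)
pose Q t := if Req_EM_T (v t) 0 then D x else (G (shift (p t) j (v t)) - G (p t)) / v t.
apply: (@is_lim_ext (fun t => v t / t * Q t)).
  move=> t; rewrite /Q; case: Req_EM_T => /= [h|h].
    by rewrite h shift0 Rminus_diag /Rdiv !Rmult_0_l.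
  (* At [t = 0] both sides are 0, since the inverse of 0 is 0. *)
  case: (Req_dec t 0) => [->|h']; last by field.
  by rewrite /Rdiv Rinv_0; ring.
apply: (is_lim_mult (fun t => v t / t) Q 0 (Rbar.Finite v') (Rbar.Finite (D x))) => //.
  apply/is_lim_spec => eps; have/is_derive_Reals/(_ eps (cond_pos eps)) [e he] := hv.
  exists e => t ht t0; have := he t t0; rewrite Rplus_0_l v0 Rminus_0_r; apply.
  by move: ht; rewrite /ball /= /AbsRing_ball /= /abs /minus /plus /opp /= Ropp_0 Rplus_0_r.
apply/is_lim_spec => eps.
have [e [e0 he]] := hc _ (cond_pos eps).
have e20 : 0 < e / 2 by lra.
have hpn : locally' 0 (fun t => forall l, Rabs (p t l - x l) < e / 2).
  have : forall s : seq 'I_d, locally' 0 (fun t => forall l, l \in s -> Rabs (p t l - x l) < e / 2).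
    elim=> [|l s IH]; first by apply: filter_forall => t l; rewrite in_nil.
    have/is_lim_spec/(_ (mkposreal _ e20)) /= h := hp l.
    apply: filter_imp (filter_and _ _ h IH) => t [h1 h2] m; rewrite inE => /orP [/eqP -> //|]; exact: h2.
  move/(_ (enum 'I_d)); apply: filter_imp => t h l; apply: h; exact: mem_enum.
have/is_lim_spec/(_ (mkposreal _ e20)) /= hvn := hv1.
apply: filter_imp (filter_and _ _ hpn hvn) => t [h1 h2].
rewrite Rminus_0_r in h2.
rewrite /Q; case: Req_EM_T => /= [_|h]; first by rewrite Rminus_diag Rabs_R0; apply: cond_pos.
have near s : Rabs s <= Rabs (v t) -> forall l, Rabs (shift (p t) j s l - x l) < e.
  move=> hs l; have h3 := shift_diff (p t) j s l.
  have := Rabs_triang (shift (p t) j s l - p t l) (p t l - x l).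
  have -> : shift (p t) j s l - p t l + (p t l - x l) = shift (p t) j s l - x l by ring.
  have := h1 l; lra.
have [c [hcc ->]] := @mvt_shift G D (p t) j (v t) ltac:(by move=> s hs; apply: hD; apply he; apply: near).
have -> : v t * D (shift (p t) j c) / v t = D (shift (p t) j c) by field.
by apply he; apply: near.
Qed.

Lemma is_lim_shift (p : R -> pt d) (v : R -> R) (j : 'I_d) x :
  (forall l, is_lim (fun t => p t l) 0 (x l)) -> is_lim v 0 0 ->
  forall l, is_lim (fun t => shift (p t) j (v t) l) 0 (x l).
Proof.
move=> hp hv l; rewrite /shift; case: eqP => _; last exact: hp.
by rewrite -[x l]Rplus_0_r; apply: is_lim_plus'.
Qed.

End Shift.

(** * The chain rule along curves in space *)

Definition ax0 : 'I_3 := @Ordinal 3 0 isT.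
Definition ax1 : 'I_3 := @Ordinal 3 1 isT.
Definition ax2 : 'I_3 := @Ordinal 3 2 isT.

Lemma ax_cases (j : 'I_3) : [\/ j = ax0, j = ax1 | j = ax2].
Proof.
case: j => [[|[|[|//]]]] h; [apply: Or31 | apply: Or32 | apply: Or33]; exact: val_inj.
Qed.

(** The increment from [c 0] to [c t] telescopes over three axis-parallel legs, and each leg
    contributes one summand in the limit. *)
Lemma chain_rule3 (U : pt 3 -> Prop) (G : pt 3 -> R) (D : 'I_3 -> pt 3 -> R)
  (c : R -> pt 3) (c' : 'I_3 -> R) :
  (forall j y, U y -> is_derive (fun t => G (shift y j t)) 0 (D j y)) ->
  (forall j, box_cont U (D j) (c 0)) ->
  (forall j, is_derive (fun t => c t j) 0 (c' j)) ->
  is_derive (fun t => G (c t)) 0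
    (c' ax0 * D ax0 (c 0) + (c' ax1 * D ax1 (c 0) + c' ax2 * D ax2 (c 0))).
Proof.
move=> hD hc hv.
pose v j t := c t j - c 0 j.
have v0 j : v j 0 = 0 by rewrite /v Rminus_diag.
have hv' j : is_derive (v j) 0 (c' j).
  rewrite -[c' j]Rminus_0_r; apply: (@is_derive_minus R_AbsRing R_NormedModule) => //.
  exact: is_derive_const.
have lv j : is_lim (v j) 0 0.
  rewrite -{2}(v0 j); apply: is_lim_continuity; apply: derivable_continuous_pt.
  by apply: ex_derive_Reals_0; exists (c' j).
pose p0 := fun _ : R => c 0.
pose p1 t := shift (p0 t) ax0 (v ax0 t).
pose p2 t := shift (p1 t) ax1 (v ax1 t).
pose p3 t := shift (p2 t) ax2 (v ax2 t).
have p3E t : p3 t = c t.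
  apply: functional_extensionality => j.
  by have [->|->|->] := ax_cases j; rewrite /p3 /p2 /p1 /p0 /shift /= /v; ring.
have l0 l : is_lim (fun t => p0 t l) 0 (c 0 l) by apply: is_lim_const.
have l1 := is_lim_shift ax0 l0 (lv ax0).
have l2 := is_lim_shift ax1 l1 (lv ax1).
have q0 := is_lim_shift_quotient (hD ax0) (hc ax0) l0 (v0 ax0) (hv' ax0).
have q1 := is_lim_shift_quotient (hD ax1) (hc ax1) l1 (v0 ax1) (hv' ax1).
have q2 := is_lim_shift_quotient (hD ax2) (hc ax2) l2 (v0 ax2) (hv' ax2).
have q := is_lim_plus' _ _ _ _ _ q0 (is_lim_plus' _ _ _ _ _ q1 q2).
apply/is_derive_Reals => eps eps0.
move/is_lim_spec/(_ (mkposreal _ eps0)): q => [e he].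
exists e => t t0 ht; rewrite Rplus_0_l.
have hb : ball 0 e t.
  by rewrite /ball /= /AbsRing_ball /= /abs /minus /plus /opp /= Ropp_0 Rplus_0_r.
have := he t hb t0 => /=.
rewrite -/(p1 t) -/(p2 t) -/(p3 t) p3E /p0.
have -> // : (G (p1 t) - G (c 0)) / t + ((G (p2 t) - G (p1 t)) / t + (G (c t) - G (p2 t)) / t) =
  (G (c t) - G (c 0)) / t by field.
Qed.

(** * Complex partial derivatives, multi-indices as sorted lists, and reordering of directions *)

Definition is_partial {d : nat} (i : 'I_d) (g : pt d -> C) (x : pt d) (l : C) : Prop :=
  is_derive (fun t => fst (g (shift x i t))) 0 (fst l) /\
  is_derive (fun t => snd (g (shift x i t))) 0 (snd l).

Lemma partial_ex_is_partial d (i : 'I_d) (g : pt d -> C) x :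
  partial_ex i g x -> is_partial i g x (partial i g x).
Proof. by case=> h1 h2; split; apply: Derive_correct. Qed.

Lemma is_partial_ex d (i : 'I_d) (g : pt d -> C) x l : is_partial i g x l -> partial_ex i g x.
Proof. by case=> h1 h2; split; [exists (fst l) | exists (snd l)]. Qed.

Lemma is_partial_unique d (i : 'I_d) (g : pt d -> C) x l : is_partial i g x l -> partial i g x = l.
Proof.
by case: l => a b [h1 h2]; rewrite /partial; congr pair; apply: is_derive_unique.
Qed.

Definition ole {d : nat} (i j : 'I_d) : bool := (i <= j)%N.

Lemma ole_total d : total (@ole d).
Proof. by move=> i j; exact: leq_total. Qed.

Lemma ole_trans d : transitive (@ole d).
Proof. by move=> i j l; exact: leq_trans. Qed.

Lemma ole_anti d : antisymmetric (@ole d).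
Proof. by move=> i j h; apply: val_inj; apply: anti_leq. Qed.

Lemma size_dirs d (b : 'I_d -> nat) : size (dirs b) = mabs b.
Proof.
rewrite /dirs size_flatten /shape -map_comp sumnE big_map big_enum /=.
by apply: eq_bigr => i _; rewrite size_nseq.
Qed.

Lemma count_dirs d (b : 'I_d -> nat) i : count_mem i (dirs b) = b i.
Proof.
rewrite /dirs count_flatten -map_comp sumnE big_map big_enum /=.
rewrite (bigD1 i) //= count_nseq /= eqxx mul1n big1 ?addn0 // => j ji.
by rewrite count_nseq /= (negbTE ji).
Qed.

Lemma sorted_dirs d (b : 'I_d -> nat) : sorted ole (dirs b).
Proof.
have hs : sorted (fun i j : 'I_d => (i < j)%N) (enum 'I_d).
  by have := iota_ltn_sorted 0 d; rewrite -val_enum_ord sorted_map.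
rewrite /dirs; elim: (enum 'I_d) hs => //= i s IH.
rewrite path_sortedE; last by move=> x y z; exact: ltn_trans.
case/andP => /allP hi /IH {}IH.
rewrite (sorted_pairwise (@ole_trans d)) pairwise_cat -!(sorted_pairwise (@ole_trans d)) IH andbT.
apply/andP; split.
  apply/allrelP => x y /nseqP [-> _] /flattenP [u /mapP [j js ->] /nseqP [-> _]].
  by apply: ltnW; apply: hi.
by elim: (b i) => //= n; case: n => //= n ->; rewrite /ole leqnn.
Qed.

(** A sorted list is determined by its multiplicities. This is the dictionary between multi-indices,
    in which all norms are stated, and lists of directions, on which the inductions run. *)
Lemma dirs_count d (l : seq 'I_d) : dirs (fun i => count_mem i l) = sort ole l.
Proof.
apply: (sorted_eq (@ole_trans d) (@ole_anti d)).
- exact: sorted_dirs.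
- exact: sort_sorted (@ole_total d) _.
by rewrite perm_sym perm_sort; apply/allP => i _ /=; rewrite count_dirs.
Qed.

Lemma mabs_count d (l : seq 'I_d) : mabs (fun i => count_mem i l) = size l.
Proof. by rewrite -size_dirs dirs_count size_sort. Qed.

(** As a merge, the insertion of [j] recurses on the sorted list, matching the induction that
    commutes derivatives. *)
Lemma sort_cons_merge d (j : 'I_d) l : sort ole (j :: l) = merge ole [:: j] (sort ole l).
Proof.
apply: (sorted_eq (@ole_trans d) (@ole_anti d)).
- exact: sort_sorted (@ole_total d) _.
- by apply: (merge_sorted (@ole_total d)) => //; exact: sort_sorted (@ole_total d) _.
by rewrite perm_sort perm_sym perm_merge /= perm_cons perm_sort.
Qed.

Lemma unif_cont_box d (U : pt d -> Prop) (g : pt d -> C) x :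
  is_open_set U -> U x -> bdd_unif_cont U g ->
  box_cont U (fun y => fst (g y)) x /\ box_cont U (fun y => snd (g y)) x.
Proof.
move=> oU ux [_ hg].
have key eps : 0 < eps -> exists r, 0 < r /\
    forall y, (forall i, Rabs (y i - x i) < r) -> U y /\ Cmod (Cminus (g y) (g x)) < eps.
  move=> eps0; have [r1 [r10 h1]] := open_box oU ux.
  have [dl [dl0 hd]] := hg _ eps0.
  have [r2 [r20 h2]] := box_pdist x dl0.
  exists (Rmin r1 r2); split; first exact: Rmin_pos.
  move=> y hy; have hU : U y by apply: h1 => i; have := hy i; have := Rmin_l r1 r2; lra.
  split => //; have -> : Cminus (g y) (g x) = Copp (Cminus (g x) (g y)) by ring.
  by rewrite Cmod_opp; apply: hd => //; apply: h2 => i; have := hy i; have := Rmin_r r1 r2; lra.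
split=> eps eps0; have [r [r0 h]] := key _ eps0; exists r; split => // y /h [uy hy];
  split => //; apply: Rle_lt_trans hy; have := Rmax_Cmod (Cminus (g y) (g x)).
  by apply: Rle_trans; apply: Rmax_l.
by apply: Rle_trans; apply: Rmax_r.
Qed.

Section CkFunction.
Variables (d k : nat) (U : pt d -> Prop) (g : pt d -> C).
Hypotheses (oU : is_open_set U) (gk : Ck_mem k U g).

Lemma Ck_mem_sorted l : sorted ole l -> (size l <= k)%N ->
  Dl_ex U l g /\ bdd_unif_cont U (Dl l g).
Proof.
move=> sl hl; have := gk (b := fun i => count_mem i l).
rewrite /Dm dirs_count mabs_count (sorted_sort (@ole_trans d) sl); exact.
Qed.

(* Only sorted lists of directions are covered by [Ck_mem]; moving [j] past smaller
   directions to its sorted position is one application of Schwarz's theorem per step. *)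
Lemma is_partial_merge j l x : sorted ole l -> (size l < k)%N -> U x ->
  is_partial j (Dl l g) x (Dl (merge ole [:: j] l) g x).
Proof.
have head i l' y : sorted ole (i :: l') -> (size l' < k)%N -> U y ->
    is_partial i (Dl l' g) y (Dl (i :: l') g y).
  by move=> sl hl uy; apply: partial_ex_is_partial; apply (Ck_mem_sorted sl hl).1.2.
elim: l x => [|i l IH] x sl hl ux; first exact: head.
have sm : sorted ole (merge ole [:: j] (i :: l)) by apply: (merge_sorted (@ole_total d)).
have hm : (size (merge ole [:: j] (i :: l)) <= k)%N by rewrite size_merge.
move: sm hm; rewrite /=; case: ifP => ji sm hm; first exact: head.
rewrite -/(merge ole [:: j] l) in sm hm *.
have sl' : sorted ole l by apply: path_sorted sl.
have hl' : (size l < k)%N by apply: ltnW.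
have [c1 c2] := unif_cont_box oU ux (Ck_mem_sorted sm hm).2.
have h1 y (uy : U y) := head i l y sl hl' uy.
have h2 y (uy : U y) := IH y sl' hl' uy.
have h3 y (uy : U y) := head i _ y sm hm uy.
split.
- apply: (schwarz_shift (G := fun y => fst (Dl l g y)) (Gi := fun y => fst (Dl (i :: l) g y))
    oU _ _ _ ux c1) => y uy; [exact: (h1 y uy).1 | exact: (h2 y uy).1 | exact: (h3 y uy).1].
- apply: (schwarz_shift (G := fun y => snd (Dl l g y)) (Gi := fun y => snd (Dl (i :: l) g y))
    oU _ _ _ ux c2) => y uy; [exact: (h1 y uy).2 | exact: (h2 y uy).2 | exact: (h3 y uy).2].
Qed.

(** Sorting makes the derivative depend only on the multiset of directions, so that a further
    direction can simply be put in front. *)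
Definition Dsort (l : seq 'I_d) : pt d -> C := Dl (sort ole l) g.

Lemma is_partial_Dsort j l x : (size l < k)%N -> U x ->
  is_partial j (Dsort l) x (Dsort (j :: l) x).
Proof.
move=> hl ux; rewrite /Dsort sort_cons_merge.
by apply: is_partial_merge => //; [exact: sort_sorted (@ole_total d) _ | rewrite size_sort].
Qed.

Lemma box_cont_Dsort l x : (size l <= k)%N -> U x ->
  box_cont U (fun y => fst (Dsort l y)) x /\ box_cont U (fun y => snd (Dsort l y)) x.
Proof.
move=> hl ux; apply: unif_cont_box => //; apply (Ck_mem_sorted (l := sort ole l)).
  exact: sort_sorted (@ole_total d) _.
by rewrite size_sort.
Qed.

End CkFunction.

(** * Lipschitz and Hoelder estimates in the plane *)

Lemma ord2_cases (i : 'I_2) : i = ord0 \/ i = ord_max.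
Proof. by case: i => [[|[|//]]] h; [left | right]; exact: val_inj. Qed.

Lemma pdist2E (x y : pt 2) :
  pdist x y = sqrt ((x ord0 - y ord0) ^ 2 + (x ord_max - y ord_max) ^ 2).
Proof.
rewrite /pdist /enorm !big_ord_recl big_ord0 Rplus_0_r.
by have -> : lift ord0 ord0 = ord_max :> 'I_2 by exact: val_inj.
Qed.

Lemma sum_abs_le_pdist (x y : pt 2) :
  Rabs (x ord0 - y ord0) + Rabs (x ord_max - y ord_max) <= sqrt 2 * pdist x y.
Proof.
rewrite pdist2E -sqrt_mult_alt; last lra.
set a := x ord0 - y ord0; set b := x ord_max - y ord_max.
have ha := Rabs_pos a; have hb := Rabs_pos b.
rewrite -[X in X <= _]sqrt_Rsqr; last lra.
apply: sqrt_le_1_alt; rewrite /Rsqr -(pow2_abs a) -(pow2_abs b).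
by have := pow2_ge_0 (Rabs a - Rabs b); nra.
Qed.

Lemma lipschitz_shift2 (g : pt 2 -> R) (dg : 'I_2 -> pt 2 -> R) M x y :
  (forall i z, is_derive (fun t => g (shift z i t)) 0 (dg i z)) ->
  (forall i z, Rabs (dg i z) <= M) ->
  Rabs (g x - g y) <= M * (Rabs (x ord0 - y ord0) + Rabs (x ord_max - y ord_max)).
Proof.
move=> hg hM.
pose z := shift y ord0 (x ord0 - y ord0).
have xE : x = shift z ord_max (x ord_max - y ord_max).
  apply: functional_extensionality => i.
  by have [->|->] := ord2_cases i; rewrite /z /shift /=; ring.
have step (w : pt 2) i t : Rabs (g (shift w i t) - g w) <= M * Rabs t.
  have [c [_ ->]] := @mvt_shift _ g (dg i) w i t ltac:(by move=> s _).
  by rewrite Rabs_mult Rmult_comm; apply: Rmult_le_compat_r; [exact: Rabs_pos | exact: hM].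
have h1 := step y ord0 (x ord0 - y ord0); rewrite -/z in h1.
have h2 := step z ord_max (x ord_max - y ord_max); rewrite -xE in h2.
have := Rabs_triang (g x - g z) (g z - g y).
have -> : g x - g z + (g z - g y) = g x - g y by ring.
lra.
Qed.

(** The mean value theorem applies to real and imaginary parts separately; recombining them costs
    this factor. *)
Lemma Cmod_le_fst_snd (z : C) B : Rabs (fst z) <= B -> Rabs (snd z) <= B -> Cmod z <= sqrt 2 * B.
Proof.
move=> h1 h2; apply: Rle_trans (Cmod_2Rmax z) _.
by apply: Rmult_le_compat_l; [exact: sqrt_pos | exact: Rmax_lub].
Qed.

(** Since [min 1 d <= d ^ alpha], a quantity bounded both by a constant and by that constant times
    the distance is Hoelder with the same constant. *)
Lemma Rle_Rpower_interpolation (alpha d c v : R) :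
  0 < alpha < 1 -> 0 < d -> 0 <= c -> v <= c -> v <= c * d -> v <= c * Rpower d alpha.
Proof.
move=> ha d0 c0 h1 h2; have e x y : x <= y -> exp x <= exp y.
  by case=> [h|->]; [apply: Rlt_le; exact: exp_increasing | lra].
case: (Rle_dec d 1) => hd.
  apply: Rle_trans h2 _; apply: Rmult_le_compat_l => //.
  rewrite -{1}(exp_ln d) // /Rpower; apply: e.
  have : ln d <= 0 by rewrite -ln_1; apply: ln_le.
  nra.
apply: Rle_trans h1 _; rewrite -{1}(Rmult_1_r c); apply: Rmult_le_compat_l => //.
rewrite -exp_0 /Rpower; apply: e.
have : 0 <= ln d by rewrite -ln_1; apply: ln_le; lra.
nra.
Qed.

(** * Derivatives of the components of [phi], and distances under [phi] *)

(** Differentiating sine or cosine shifts it by a quarter period, so one formula covers all orders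
    [a]. The third component of [phi] is independent of the longitude: its factor is 1, with
    derivatives 0. *)
Definition lon (j : 'I_3) (a : nat) (u : R) : R :=
  match nat_of_ord j with
  | 0%nat => cos (u + INR a * (PI / 2))
  | 1%nat => sin (u + INR a * (PI / 2))
  | _ => if a is 0%nat then 1 else 0
  end.

Definition lat (j : 'I_3) (b : nat) (u : R) : R :=
  match nat_of_ord j with
  | 0%nat | 1%nat => sin (u + INR b * (PI / 2))
  | _ => cos (u + INR b * (PI / 2))
  end.

Lemma cos_quarter_succ u a : cos (u + INR a.+1 * (PI / 2)) = - sin (u + INR a * (PI / 2)).
Proof.
rewrite S_INR (_ : u + _ = PI / 2 + (u + INR a * (PI / 2))); last by ring.
by rewrite [sin _]sin_cos; ring.
Qed.

Lemma sin_quarter_succ u a : sin (u + INR a.+1 * (PI / 2)) = cos (u + INR a * (PI / 2)).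
Proof.
rewrite S_INR (_ : u + _ = PI / 2 + (u + INR a * (PI / 2))); last by ring.
by rewrite -cos_sin.
Qed.

Lemma is_derive_lon j a u : is_derive (lon j a) u (lon j a.+1 u).
Proof.
rewrite /lon; case: (nat_of_ord j) => [|[|n]].
- by rewrite cos_quarter_succ; auto_derive; [|ring].
- by rewrite sin_quarter_succ; auto_derive; [|ring].
- exact: is_derive_const.
Qed.

Lemma is_derive_lat j b u : is_derive (lat j b) u (lat j b.+1 u).
Proof.
rewrite /lat; case: (nat_of_ord j) => [|[|n]].
- by rewrite sin_quarter_succ; auto_derive; [|ring].
- by rewrite sin_quarter_succ; auto_derive; [|ring].
- by rewrite cos_quarter_succ; auto_derive; [|ring].
Qed.

Lemma lon_bound j a u : Rabs (lon j a u) <= 1.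
Proof.
rewrite /lon; apply: Rabs_le; case: (nat_of_ord j) => [|[|n]];
  [exact: COS_bound | exact: SIN_bound | case: a => [|a]; lra].
Qed.

Lemma lat_bound j b u : Rabs (lat j b u) <= 1.
Proof.
rewrite /lat; apply: Rabs_le; case: (nat_of_ord j) => [|[|n]];
  [exact: SIN_bound | exact: SIN_bound | exact: COS_bound].
Qed.

(* [dphi (j, w)] is the derivative of the [j]-th component of [phi] in the directions [w]. *)
Definition dphi (c : 'I_3 * seq 'I_2) (x : pt 2) : R :=
  lon c.1 (count_mem ord0 c.2) (x ord0) * lat c.1 (count_mem ord_max c.2) (x ord_max).

Lemma phi_dphi x j : phi x j = dphi (j, [::]) x.
Proof.
rewrite /phi /dphi /lon /lat /=; case: (nat_of_ord j) => [|[|n]] /=;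
  rewrite !Rmult_0_l !Rplus_0_r //; ring.
Qed.

Lemma dphi_bound c x : Rabs (dphi c x) <= 1.
Proof.
rewrite /dphi Rabs_mult -(Rmult_1_r 1).
apply: Rmult_le_compat; [exact: Rabs_pos | exact: Rabs_pos | exact: lon_bound | exact: lat_bound].
Qed.

Lemma is_derive_dphi j w i x :
  is_derive (fun t => dphi (j, w) (shift x i t)) 0 (dphi (j, i :: w) x).
Proof.
have tr (h : R -> R) u l : is_derive h u l -> is_derive (fun t => h (u + t)) 0 l.
  move=> hh; rewrite -[l]Rmult_1_l.
  apply: (@is_derive_comp _ _ h (fun t => u + t)); first by rewrite Rplus_0_r.
  by auto_derive; [|ring].
have [->|->] := ord2_cases i; rewrite /dphi /shift /=.
  rewrite Rmult_comm; apply: (is_derive_ext (fun t =>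
    lat j (count_mem ord_max w) (x ord_max) * lon j (count_mem ord0 w) (x ord0 + t))).
    by move=> t; rewrite Rmult_comm.
  by apply: is_derive_scal; apply: tr; exact: is_derive_lon.
by apply: is_derive_scal; apply: tr; exact: is_derive_lat.
Qed.

(** The gradient bound gives [sqrt 2], rounded up to 2 so that it coincides with the trivial bound
    on a difference of two values in [[-1, 1]]. *)
Lemma dphi_lipschitz c x y : Rabs (dphi c x - dphi c y) <= 2 * pdist x y.
Proof.
case: c => j w; apply: Rle_trans
  (@lipschitz_shift2 (dphi (j, w)) (fun i => dphi (j, i :: w)) 1 x y _ _) _.
- by move=> i z; exact: is_derive_dphi.
- by move=> i z; exact: dphi_bound.
have := sum_abs_le_pdist x y; have := pdist_ge0 x y.
have : sqrt 2 <= 2 by rewrite -[X in _ <= X]sqrt_Rsqr /Rsqr; [apply: sqrt_le_1_alt; lra | lra].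
nra.
Qed.

Lemma sphere_phi x : sphere (phi x).
Proof.
rewrite /sphere /enorm !big_ord_recl big_ord0 /phi /= -[X in _ = X]sqrt_1; congr sqrt.
have h1 := sin2_cos2 (x ord0); have h2 := sin2_cos2 (x ord_max); rewrite /Rsqr in h1 h2.
nra.
Qed.

(** The squared distance of the images is the squared chord of the latitude difference plus
    [sin t * sin t'] times that of the longitude difference; a chord is at most its arc, and the
    weight is at most 1. Hence top-order Hoelder constants pass from the sphere to the plane without
    loss. *)
Lemma phi_nonexpansive x y : pdist (phi x) (phi y) <= pdist x y.
Proof.
rewrite pdist2E /pdist /enorm !big_ord_recl big_ord0 /phi /=; apply: sqrt_le_1_alt.
set l := x ord0; set t := x ord_max; set l' := y ord0; set t' := y ord_max.
have h1 := sin2_cos2 l; have h2 := sin2_cos2 t.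
have h3 := sin2_cos2 l'; have h4 := sin2_cos2 t'.
have chord u v : 2 - 2 * (cos u * cos v + sin u * sin v) <= (u - v) ^ 2.
  rewrite -cos_minus.
  have e : cos (u - v) = 1 - 2 * (sin ((u - v) / 2) * sin ((u - v) / 2)).
    by rewrite -Rmult_assoc -cos_2a_sin; congr cos; field.
  have hs : Rabs (sin ((u - v) / 2)) <= Rabs ((u - v) / 2).
    have [c [_]] := @mvt_origin sin cos ((u - v) / 2) ltac:(by move=> w _; auto_derive; [|ring]).
    rewrite sin_0 Rminus_0_r => ->; rewrite Rabs_mult -{2}(Rmult_1_r (Rabs ((u - v) / 2))).
    apply: Rmult_le_compat_l; first exact: Rabs_pos.
    by apply: Rabs_le; exact: COS_bound.
  have := Rsqr_le_abs_1 _ _ hs; rewrite e /Rsqr; nra.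
have c1 := chord l l'; have c2 := chord t t'.
have s1 := SIN_bound t; have s2 := SIN_bound t'.
have q0 : 0 <= 2 - 2 * (cos l * cos l' + sin l * sin l').
  by rewrite -cos_minus; have := COS_bound (l - l'); lra.
have q1 : sin t * sin t' <= 1 by nra.
rewrite /Rsqr in h1 h2 h3 h4.
have -> : (cos l * sin t - cos l' * sin t') * ((cos l * sin t - cos l' * sin t') * 1) +
  ((sin l * sin t - sin l' * sin t') * ((sin l * sin t - sin l' * sin t') * 1) +
  ((cos t - cos t') * ((cos t - cos t') * 1) + 0)) =
  (2 - 2 * (cos t * cos t' + sin t * sin t')) +
  sin t * sin t' * (2 - 2 * (cos l * cos l' + sin l * sin l')).
  have -> : 2 - 2 * (cos t * cos t' + sin t * sin t') =
    (sin t * sin t + cos t * cos t) + (sin t' * sin t' + cos t' * cos t')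
    - 2 * (cos t * cos t' + sin t * sin t') by rewrite h2 h4; ring.
  transitivity ((sin l * sin l + cos l * cos l) * (sin t * sin t)
    + (sin l' * sin l' + cos l' * cos l') * (sin t' * sin t')
    - 2 * (sin t * sin t') * (cos l * cos l' + sin l * sin l') + (cos t - cos t') * (cos t - cos t')).
    by ring.
  by rewrite h1 h3; ring.
simpl in c1, c2; nra.
Qed.

(** * Complex sums and products, and the terms of the iterated chain rule *)

Lemma is_partial_plus d (i : 'I_d) (g h : pt d -> C) x a b :
  is_partial i g x a -> is_partial i h x b ->
  is_partial i (fun y => Cplus (g y) (h y)) x (Cplus a b).
Proof.
by move=> [g1 g2] [h1 h2]; split; apply: (@is_derive_plus R_AbsRing R_NormedModule).
Qed.

Lemma is_partial_const d (i : 'I_d) (c : C) x : is_partial i (fun _ => c) x (RtoC 0).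
Proof. by split; exact: is_derive_const. Qed.

Lemma is_partial_real_mult d (i : 'I_d) (w : pt d -> R) (h : pt d -> C) x w' h' :
  is_derive (fun t => w (shift x i t)) 0 w' -> is_partial i h x h' ->
  is_partial i (fun y => Cmult (RtoC (w y)) (h y)) x
    (Cplus (Cmult (RtoC w') (h x)) (Cmult (RtoC (w x)) h')).
Proof.
move=> hw [h1 h2].
have mul (p : pt d -> R) p' : is_derive (fun t => p (shift x i t)) 0 p' ->
    is_derive (fun t => w (shift x i t) * p (shift x i t)) 0 (w' * p x + w x * p').
  move=> hp; have := @is_derive_mult R_AbsRing (fun t => w (shift x i t)) (fun t => p (shift x i t))
    0 w' p' hw hp Rmult_comm.
  by rewrite /plus /mult /= shift0.
split.
- apply: (is_derive_ext (fun t => w (shift x i t) * fst (h (shift x i t)))).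
    by move=> t /=; ring.
  have := mul (fun y => fst (h y)) _ h1; congr is_derive => /=; ring.
- apply: (is_derive_ext (fun t => w (shift x i t) * snd (h (shift x i t)))).
    by move=> t /=; ring.
  have := mul (fun y => snd (h y)) _ h2; congr is_derive => /=; ring.
Qed.

Definition csum (s : seq C) : C := foldr Cplus (RtoC 0) s.

Lemma csum_cat s1 s2 : csum (s1 ++ s2) = Cplus (csum s1) (csum s2).
Proof. by elim: s1 => [|z s IH] /=; rewrite ?IH; ring. Qed.

Lemma csum_map_mult (T : Type) (z : C) (F : T -> C) (s : seq T) :
  csum [seq Cmult z (F t) | t <- s] = Cmult z (csum (map F s)).
Proof. by elim: s => [|t s IH] /=; rewrite ?IH; ring. Qed.

Lemma Cmod_csum (T : eqType) (F : T -> C) (s : seq T) (B : R) :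
  (forall t, t \in s -> Cmod (F t) <= B) -> Cmod (csum (map F s)) <= INR (size s) * B.
Proof.
elim: s => [|t s IH] h; first by rewrite /= Cmod_0; lra.
rewrite -[size _]/(size s).+1 S_INR /=; apply: Rle_trans (Cmod_triangle _ _) _.
have h1 := h t (mem_head _ _).
suff : Cmod (csum (map F s)) <= INR (size s) * B by lra.
by apply: IH => u hu; apply: h; rewrite inE hu orbT.
Qed.

Lemma csum_sub (T : Type) (F G : T -> C) (s : seq T) :
  Cminus (csum (map F s)) (csum (map G s)) = csum [seq Cminus (F t) (G t) | t <- s].
Proof. by elim: s => [|t s IH] /=; rewrite -?IH; ring. Qed.

(* A term [(ws, l)] stands for the product of the [dphi c], [c] in [ws], times the
   derivative of the extension in the directions [l], taken at [phi x]. *)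
Definition term : Type := seq ('I_3 * seq 'I_2) * seq 'I_3.

Fixpoint wval (ws : seq ('I_3 * seq 'I_2)) (x : pt 2) : R :=
  if ws is c :: ws' then dphi c x * wval ws' x else 1.

Fixpoint dfactors (i : 'I_2) (ws : seq ('I_3 * seq 'I_2)) : seq (seq ('I_3 * seq 'I_2)) :=
  if ws is (j, w) :: ws' then ((j, i :: w) :: ws') :: map (cons (j, w)) (dfactors i ws') else [::].

Definition dterm (i : 'I_2) (t : term) : seq term :=
  [seq (ws, t.2) | ws <- dfactors i t.1] ++
  [seq ((j, [:: i]) :: t.1, j :: t.2) | j <- [:: ax0; ax1; ax2]].

Fixpoint dterms (l : seq 'I_2) : seq term :=
  if l is i :: l' then flatten (map (dterm i) (dterms l')) else [:: ([::], [::])].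

Lemma size_dfactors i ws : size (dfactors i ws) = size ws.
Proof. by elim: ws => [|[j w] ws IH] //=; rewrite size_map IH. Qed.

Lemma size_in_dfactors i ws vs : vs \in dfactors i ws -> size vs = size ws.
Proof.
elim: ws vs => [|[j w] ws IH] vs //=; rewrite inE => /orP [/eqP -> //|/mapP [us hus ->]] /=.
by rewrite (IH _ hus).
Qed.

(** The product rule changes neither length, and the chain rule lengthens both by one. The number of
    factors thus equals the order of the outer derivative, which the term count and the Hoelder
    constant both rely on. *)
Lemma dterms_size l t : t \in dterms l -> size t.1 = size t.2 /\ (size t.2 <= size l)%N.
Proof.
elim: l t => [|i l IH] t; first by rewrite inE => /eqP ->.
case/flattenP => u /mapP [[ws m] /IH /= [e hm] ->].
rewrite mem_cat => /orP [/mapP [vs /size_in_dfactors hv ->]|/mapP [j _ ->]] /=.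
  by rewrite hv; split => //; apply: leqW.
by rewrite e.
Qed.

(* Differentiating a term with [m] factors gives [m + 3] terms, and [m <= n] after [n] steps. *)
Lemma dterms_count l : (2 * size (dterms l) <= fact (size l + 2))%N.
Proof.
elim: l => [|i l IH] //.
have h : (size (flatten (map (dterm i) (dterms l))) <= (size l + 3) * size (dterms l))%N.
  have : forall s, (forall t, t \in s -> size t.1 = size t.2 /\ (size t.2 <= size l)%N) ->
      (size (flatten (map (dterm i) s)) <= (size l + 3) * size s)%N.
    elim=> [|t s IHs] ht //=; rewrite size_cat size_cat !size_map size_dfactors /= mulnS.
    have [-> h1] := ht t (mem_head _ _); apply: leq_add; first by rewrite leq_add2r.
    by apply: IHs => u hu; apply: ht; rewrite inE hu orbT.
  by apply; exact: dterms_size.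
apply: leq_trans (_ : (2 * ((size l + 3) * size (dterms l)) <= _)%N); first by rewrite leq_mul2l.
rewrite mulnCA.
have -> : fact (size (i :: l) + 2) = ((size l + 3) * fact (size l + 2))%N.
  by rewrite (addnS _ 2) mulSn.
by rewrite leq_mul2l IH orbT.
Qed.

Lemma wval_bound ws x : Rabs (wval ws x) <= 1.
Proof.
elim: ws => [|c ws IH] /=; first by rewrite Rabs_R1; lra.
rewrite Rabs_mult -(Rmult_1_r 1).
by apply: Rmult_le_compat; [exact: Rabs_pos | exact: Rabs_pos | exact: dphi_bound |].
Qed.

Lemma is_derive_wval ws i x :
  is_derive (fun t => wval ws (shift x i t)) 0 (foldr Rplus 0 [seq wval vs x | vs <- dfactors i ws]).
Proof.
elim: ws => [|[j w] ws IH] /=; first exact: is_derive_const.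
have := @is_derive_mult R_AbsRing (fun t => dphi (j, w) (shift x i t))
  (fun t => wval ws (shift x i t)) 0 _ _ (is_derive_dphi j w i x) IH Rmult_comm.
rewrite /plus /mult /= shift0; congr is_derive; congr (_ + _).
by elim: (dfactors i ws) => [|vs s IHs] /=; rewrite ?Rmult_0_r // -IHs; ring.
Qed.

(** * Bounds for the derivatives of a composition with [phi] *)

Section Expansion.
(** [H l] plays the role of the derivative of the extension in the directions [l]. It is seen only
    through [phi], and [H_holder] already measures distances in the plane. *)
Variables (k : nat) (alpha N : R) (H : seq 'I_3 -> pt 3 -> C).
Hypothesis alpha01 : 0 < alpha < 1.
Hypothesis H_bound : forall l x, (size l <= k)%N -> Cmod (H l (phi x)) <= N.
Hypothesis H_holder : forall l x y, size l = k -> x <> y ->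
  Cmod (Cminus (H l (phi x)) (H l (phi y))) <= N * Rpower (pdist x y) alpha.
Hypothesis H_chain : forall l i x, (size l < k)%N ->
  is_partial i (fun y => H l (phi y)) x
    (csum [seq Cmult (RtoC (dphi (j, [:: i]) x)) (H (j :: l) (phi x)) | j <- [:: ax0; ax1; ax2]]).

Definition tval (t : term) (x : pt 2) : C := Cmult (RtoC (wval t.1 x)) (H t.2 (phi x)).

Definition tsum (s : seq term) (x : pt 2) : C := csum [seq tval t x | t <- s].

Lemma N_ge0 : 0 <= N.
Proof. by apply: Rle_trans (Cmod_ge_0 _) (H_bound (l := [::]) (fun _ => 0) _). Qed.

Lemma is_partial_tval t i x : (size t.2 < k)%N -> is_partial i (tval t) x (tsum (dterm i t) x).
Proof.
case: t => ws l hl.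
have := is_partial_real_mult (is_derive_wval ws i x) (H_chain i x hl).
congr is_partial; rewrite /tsum /dterm map_cat csum_cat; congr Cplus.
  rewrite -map_comp; elim: (dfactors i ws) => [|vs s IH] /=; first by rewrite Cmult_0_l.
  by rewrite -IH RtoC_plus /tval /=; ring.
rewrite -map_comp -csum_map_mult; congr csum; apply: eq_map => j.
by rewrite /tval /= RtoC_mult; ring.
Qed.

Lemma is_partial_tsum s i x : (forall t, t \in s -> (size t.2 < k)%N) ->
  is_partial i (tsum s) x (tsum (flatten (map (dterm i) s)) x).
Proof.
elim: s => [|t s IH] hs; first exact: is_partial_const.
rewrite /= /tsum map_cat csum_cat /=; apply: is_partial_plus.
  by apply: is_partial_tval; apply: hs; exact: mem_head.
by apply: IH => u hu; apply: hs; rewrite inE hu orbT.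
Qed.

Lemma Dl_expansion l : (size l <= k)%N ->
  Dl_ex (setT_pt 2) l (fun x => H [::] (phi x)) /\
  Dl l (fun x => H [::] (phi x)) = tsum (dterms l).
Proof.
elim: l => [|i l IH] hl.
  split => //; apply: functional_extensionality => x.
  by rewrite /tsum /tval /=; ring.
have [h1 h2] := IH (ltnW hl).
have hp x : is_partial i (tsum (dterms l)) x (tsum (dterms (i :: l)) x).
  apply: is_partial_tsum => t /dterms_size [_]; rewrite -ltnS => h; exact: leq_trans h hl.
rewrite /= h2; split; last by apply: functional_extensionality => x; exact: is_partial_unique.
by split => // x _; exact: is_partial_ex (hp x).
Qed.

Lemma tval_bound t x : (size t.2 <= k)%N -> Cmod (tval t x) <= N.
Proof.
move=> ht; rewrite /tval Cmod_mult Cmod_R -(Rmult_1_l N).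
by apply: Rmult_le_compat; [exact: Rabs_pos | exact: Cmod_ge_0 | exact: wval_bound | exact: H_bound].
Qed.

(** Telescoping a product of factors bounded by 1 adds their Hoelder constants. *)
Lemma wval_holder ws x y : x <> y ->
  Rabs (wval ws x - wval ws y) <= 2 * INR (size ws) * Rpower (pdist x y) alpha.
Proof.
move=> xy; elim: ws => [|c ws IH]; first by rewrite /= Rminus_diag Rabs_R0; lra.
have hc : Rabs (dphi c x - dphi c y) <= 2 * Rpower (pdist x y) alpha.
  apply: Rle_Rpower_interpolation => //; [exact: pdist_gt0 | lra | | exact: dphi_lipschitz].
  have := Rabs_triang (dphi c x) (- dphi c y); rewrite Rabs_Ropp.
  have := dphi_bound c x; have := dphi_bound c y; rewrite /Rminus; lra.
rewrite -[size _]/(size ws).+1 S_INR /=.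
have -> : dphi c x * wval ws x - dphi c y * wval ws y =
  (dphi c x - dphi c y) * wval ws x + dphi c y * (wval ws x - wval ws y) by ring.
apply: Rle_trans (Rabs_triang _ _) _.
rewrite (Rabs_mult (dphi c x - dphi c y)) (Rabs_mult (dphi c y)).
have h1 : Rabs (dphi c x - dphi c y) * Rabs (wval ws x) <= 2 * Rpower (pdist x y) alpha * 1.
  by apply: Rmult_le_compat => //; [exact: Rabs_pos | exact: Rabs_pos | exact: wval_bound].
have h2 : Rabs (dphi c y) * Rabs (wval ws x - wval ws y) <=
    1 * (2 * INR (size ws) * Rpower (pdist x y) alpha).
  by apply: Rmult_le_compat => //; [exact: Rabs_pos | exact: Rabs_pos | exact: dphi_bound].
lra.
Qed.

(** By the chain rule each partial derivative in the plane is a sum of three terms of size at most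
    [N]. The bound [3 N] picks up one [sqrt 2] from comparing the sum of coordinates with the
    distance and another from real and imaginary parts, whence [6 N]; this also exceeds the trivial
    bound [2 N]. *)
Lemma H_lower_holder l x y : (size l < k)%N -> x <> y ->
  Cmod (Cminus (H l (phi x)) (H l (phi y))) <= 6 * N * Rpower (pdist x y) alpha.
Proof.
move=> hl xy; have n0 := N_ge0.
apply: Rle_Rpower_interpolation => //; [exact: pdist_gt0 | lra | |].
  apply: Rle_trans (Cmod_triangle _ _) _; rewrite Cmod_opp.
  have := H_bound x (ltnW hl); have := H_bound y (ltnW hl); lra.
pose dg i z := csum [seq Cmult (RtoC (dphi (j, [:: i]) z)) (H (j :: l) (phi z))
  | j <- [:: ax0; ax1; ax2]].
have hd i z : Cmod (dg i z) <= 3 * N.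
  have -> : 3 = INR (size [:: ax0; ax1; ax2]) by rewrite /=; ring.
  apply: Cmod_csum => j _; rewrite Cmod_mult Cmod_R -(Rmult_1_l N).
  by apply: Rmult_le_compat; [exact: Rabs_pos | exact: Cmod_ge_0 | exact: dphi_bound | exact: H_bound].
have hm i z := Rmax_Cmod (dg i z).
have hs := sum_abs_le_pdist x y.
have -> : 6 * N * pdist x y = sqrt 2 * (3 * N * (sqrt 2 * pdist x y)).
  have := sqrt_sqrt 2 ltac:(lra) => e.
  by transitivity (3 * N * pdist x y * (sqrt 2 * sqrt 2)); [rewrite e | ]; ring.
apply: Cmod_le_fst_snd.
- apply: Rle_trans (@lipschitz_shift2 (fun z => fst (H l (phi z))) (fun i z => fst (dg i z))
    (3 * N) x y _ _) _.
  + by move=> i z; exact: (H_chain i z hl).1.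
  + move=> i z; apply: Rle_trans (hd i z); apply: Rle_trans (hm i z); exact: Rmax_l.
  + by apply: Rmult_le_compat_l => //; lra.
- apply: Rle_trans (@lipschitz_shift2 (fun z => snd (H l (phi z))) (fun i z => snd (dg i z))
    (3 * N) x y _ _) _.
  + by move=> i z; exact: (H_chain i z hl).2.
  + move=> i z; apply: Rle_trans (hd i z); apply: Rle_trans (hm i z); exact: Rmax_r.
  + by apply: Rmult_le_compat_l => //; lra.
Qed.

Lemma tval_holder t x y : (size t.2 <= k)%N -> size t.1 = size t.2 -> x <> y ->
  Cmod (Cminus (tval t x) (tval t y)) <= 2 * (INR k + 3) * N * Rpower (pdist x y) alpha.
Proof.
case: t => ws l /= hl hw xy; rewrite /tval /=.
have n0 := N_ge0.
have rho0 : 0 < Rpower (pdist x y) alpha by exact: exp_pos.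
set rho := Rpower _ _ in rho0 *.
(* Of the budget [2 (k + 3) N], the [m] factors consume [2 m N]. What remains is [6 N] if [m = k],
   where [N] suffices, and at least [8 N] if [m < k], where [6 N] suffices. *)
have h1 : Cmod (Cminus (H l (phi x)) (H l (phi y))) <=
    (2 * (INR k + 3) - 2 * INR (size ws)) * N * rho.
  rewrite hw; have r0 : 0 <= N * rho by apply: Rmult_le_pos; lra.
  move: hl; rewrite leq_eqVlt => /orP [/eqP e|hlt].
    have := H_holder e xy; rewrite -/rho e; nra.
  have := H_lower_holder hlt xy; rewrite -/rho.
  have : INR (size l) + 1 <= INR k by rewrite -S_INR; apply: le_INR; apply/leP.
  nra.
have -> : Cminus (Cmult (RtoC (wval ws x)) (H l (phi x))) (Cmult (RtoC (wval ws y)) (H l (phi y))) =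
  Cplus (Cmult (RtoC (wval ws x - wval ws y)) (H l (phi x)))
    (Cmult (RtoC (wval ws y)) (Cminus (H l (phi x)) (H l (phi y)))).
  by rewrite RtoC_minus; ring.
apply: Rle_trans (Cmod_triangle _ _) _; rewrite !Cmod_mult !Cmod_R.
have h2 := wval_holder ws xy; rewrite -/rho in h2.
have h3 : Rabs (wval ws x - wval ws y) * Cmod (H l (phi x)) <= 2 * INR (size ws) * rho * N.
  by apply: Rmult_le_compat => //; [exact: Rabs_pos | exact: Cmod_ge_0 | exact: H_bound].
have h4 := wval_bound ws y.
have h5 := Cmod_ge_0 (Cminus (H l (phi x)) (H l (phi y))).
nra.
Qed.

Lemma half_fact_bound l : INR (size (dterms l)) <= INR (fact (size l + 2)) / 2.
Proof.
have /leP/le_INR := dterms_count l; rewrite mult_INR -[INR 2]/2; lra.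
Qed.

Lemma Dl_bound l x : (size l <= k)%N ->
  Cmod (Dl l (fun x => H [::] (phi x)) x) <= INR (fact (size l + 2)) / 2 * N.
Proof.
move=> hl; rewrite (Dl_expansion hl).2.
apply: Rle_trans (_ : INR (size (dterms l)) * N <= _).
  by apply: Cmod_csum => t /dterms_size [_ h]; apply: tval_bound; exact: leq_trans hl.
by apply: Rmult_le_compat_r; [exact: N_ge0 | exact: half_fact_bound].
Qed.

(** All orders up to [k] are covered because the estimate also supplies the uniform continuity
    demanded by [Ck_mem]. *)
Lemma Dl_holder l x y : (size l <= k)%N -> x <> y ->
  Cmod (Cminus (Dl l (fun x => H [::] (phi x)) x) (Dl l (fun x => H [::] (phi x)) y)) <=
  INR (fact (k + 3)) * N * Rpower (pdist x y) alpha.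
Proof.
move=> hl xy; rewrite (Dl_expansion hl).2 /tsum csum_sub.
have n0 := N_ge0; have r0 : 0 < Rpower (pdist x y) alpha by exact: exp_pos.
have k0 := pos_INR k.
apply: Rle_trans
  (_ : INR (size (dterms l)) * (2 * (INR k + 3) * N * Rpower (pdist x y) alpha) <= _).
  apply: Cmod_csum => t /dterms_size [e h]; apply: tval_holder => //; exact: leq_trans hl.
have h1 := half_fact_bound l.
have h2 : INR (fact (size l + 2)) <= INR (fact (k + 2)).
  by apply: le_INR; apply: fact_le; apply/leP; rewrite leq_add2r.
have -> : INR (fact (k + 3)) = (INR k + 3) * INR (fact (k + 2)).
  have -> : fact (k + 3) = ((k + 3) * fact (k + 2))%N by rewrite (addnS k 2) mulSn.
  by rewrite mult_INR plus_INR; congr (_ * _); rewrite /=; ring.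
have -> : (INR k + 3) * INR (fact (k + 2)) * N * Rpower (pdist x y) alpha =
  INR (fact (k + 2)) / 2 * (2 * (INR k + 3) * N * Rpower (pdist x y) alpha) by field.
apply: Rmult_le_compat_r; last lra.
by apply: Rmult_le_pos; [apply: Rmult_le_pos; lra | lra].
Qed.

End Expansion.

(** * Suprema and norms with values in the extended reals *)

Lemma Rbar_lub_correct (E : Rbar -> Prop) : Rbar_is_lub E (Rbar_lub E).
Proof. exact: proj2_sig (Rbar_ex_lub E). Qed.

Lemma Rbar_glb_correct (E : Rbar -> Prop) : Rbar_is_glb E (Rbar_glb E).
Proof. exact: proj2_sig (Rbar_ex_glb E). Qed.

Lemma Rbar_lub_le (E : Rbar -> Prop) b : (forall v, E v -> Rbar_le v b) -> Rbar_le (Rbar_lub E) b.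
Proof. by move=> h; apply (Rbar_lub_correct E).2. Qed.

Lemma le_Rbar_lub (E : Rbar -> Prop) v : E v -> Rbar_le v (Rbar_lub E).
Proof. by move=> h; apply (Rbar_lub_correct E).1. Qed.

Lemma supC_le d (U : pt d -> Prop) h M :
  0 <= M -> (forall x, U x -> Cmod (h x) <= M) -> Rbar_le (supC U h) (Rbar.Finite M).
Proof. by move=> m0 hM; apply: Rbar_lub_le => v [->|[x [ux ->]]] //=; exact: hM. Qed.

Lemma le_supC d (U : pt d -> Prop) h x : U x -> Rbar_le (Rbar.Finite (Cmod (h x))) (supC U h).
Proof. by move=> ux; apply: le_Rbar_lub; right; exists x. Qed.

Lemma supC_ge0 d (U : pt d -> Prop) h : Rbar_le (Rbar.Finite 0) (supC U h).
Proof. by apply: le_Rbar_lub; left. Qed.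

Lemma holder_semi_ge0 d k alpha (U : pt d -> Prop) h :
  Rbar_le (Rbar.Finite 0) (holder_semi k alpha U h).
Proof. by apply: le_Rbar_lub; left. Qed.

Lemma Rbar_plus_ge0 a b : Rbar_le (Rbar.Finite 0) a -> Rbar_le (Rbar.Finite 0) b ->
  Rbar_le (Rbar.Finite 0) (Rbar_plus a b).
Proof. by case: a => [a||] //; case: b => [b||] //=; lra. Qed.

(** Nonnegativity rules out [p_infty + m_infty], to which [Rbar_plus] assigns 0. *)
Lemma le_Rbar_plusl a b : Rbar_le (Rbar.Finite 0) b -> Rbar_le a (Rbar_plus a b).
Proof. by case: a => [a||] //; case: b => [b||] //=; lra. Qed.

Lemma le_Rbar_plusr a b : Rbar_le (Rbar.Finite 0) a -> Rbar_le b (Rbar_plus a b).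
Proof. by case: a => [a||] //; case: b => [b||] //=; lra. Qed.

Lemma Ck_norm_ge0 d k (U : pt d -> Prop) h : Rbar_le (Rbar.Finite 0) (Ck_norm k U h).
Proof.
apply: big_ind => [|a b|b _]; [exact: Rbar_le_refl | exact: Rbar_plus_ge0 | exact: supC_ge0].
Qed.

Lemma le_Rbar_big (I : eqType) (s : seq I) (P : pred I) (F : I -> Rbar) i :
  (forall j, Rbar_le (Rbar.Finite 0) (F j)) -> i \in s -> P i ->
  Rbar_le (F i) (\big[Rbar_plus/Rbar.Finite 0]_(j <- s | P j) F j).
Proof.
move=> h0; elim: s => // j s IH; rewrite inE big_cons => /orP [/eqP <-|hs] hP.
  rewrite hP; apply: le_Rbar_plusl.
  by apply: big_ind => [|a b|b _]; [exact: Rbar_le_refl | exact: Rbar_plus_ge0 | exact: h0].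
apply: Rbar_le_trans (IH hs hP) _; case: (P j); last exact: Rbar_le_refl.
exact: le_Rbar_plusr.
Qed.

Lemma supC_le_Ck_norm d k (U : pt d -> Prop) g (b : 'I_d -> nat) :
  (mabs b <= k)%N -> Rbar_le (supC U (Dm b g)) (Ck_norm k U g).
Proof.
(* Every entry of [b] is at most [mabs b <= k], so [inord] does not alter it. *)
move=> hb; pose c : {ffun 'I_d -> 'I_k.+1} := [ffun i => inord (b i)].
have cE : (fun i => nat_of_ord (c i)) = b.
  apply: functional_extensionality => i; rewrite ffunE inordK // ltnS.
  by apply: leq_trans hb; rewrite /mabs (bigD1 i) //= leq_addr.
rewrite -{1}cE; apply: (@le_Rbar_big _ _
  (fun c : {ffun 'I_d -> 'I_k.+1} => (mabs (fun i => nat_of_ord (c i)) <= k)%N)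
  (fun c : {ffun 'I_d -> 'I_k.+1} => supC U (Dm (fun i => nat_of_ord (c i)) g))).
- by move=> j; exact: supC_ge0.
- exact: mem_index_enum.
- by rewrite cE.
Qed.

(** * Summing the term counts over all multi-indices *)

(** The last factorial dominates: the induction step amounts to [3 <= k + 3]. The resulting 3/2,
    halved by the term count, is the origin of 3/4. *)
Lemma sum_fact_le k : (2 * \sum_(n < k.+1) fact (n + 2) <= 3 * fact (k + 2))%N.
Proof.
elim: k => [|k IH]; first by rewrite big_ord_recl big_ord0.
rewrite big_ord_recr mulnDr.
apply: leq_trans (leq_add IH (leqnn _)) _.
have -> : fact (k.+1 + 2) = ((k + 3) * fact (k + 2))%N by rewrite (addnS k 2) addSn mulSn.
rewrite mulnA mulnA -mulnDl leq_mul2r; apply/orP; right.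
by rewrite (mulSn 2) leq_add2r leq_addl.
Qed.

(** In two variables the order and the first entry determine the multi-index. *)
Lemma card_mabs2_le k n :
  (#|[pred b : {ffun 'I_2 -> 'I_k.+1} | mabs (fun i => nat_of_ord (b i)) == n]| <= k.+1)%N.
Proof.
rewrite -[X in (_ <= X)%N]card_ord.
apply: (@leq_card_in _ _ (fun b : {ffun 'I_2 -> 'I_k.+1} => b ord0)) => b c.
rewrite !inE /mabs !big_ord_recl !big_ord0 !addn0 => /eqP hb /eqP hc e.
apply/ffunP => i; have [->|->] := ord2_cases i; first exact: e.
have l0 : lift ord0 ord0 = ord_max :> 'I_2 by exact: val_inj.
apply: val_inj; apply: (@addnI (b ord0)); rewrite -l0 /= hb e; exact/esym.
Qed.

(** Grouping by order leaves at most [k + 1] multi-indices for each; since [k + 1 <= k + 3], this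
    factor is absorbed in passing from [(k + 2)!] to [(k + 3)!]. *)
Lemma sum_fact_mabs2_le k :
  (2 * \sum_(b : {ffun 'I_2 -> 'I_k.+1} | (mabs (fun i => nat_of_ord (b i)) <= k)%N)
     fact (mabs (fun i => nat_of_ord (b i)) + 2) <= 3 * fact (k + 3))%N.
Proof.
pose m (b : {ffun 'I_2 -> 'I_k.+1}) := mabs (fun i => nat_of_ord (b i)).
rewrite (partition_big (fun b => inord (m b) : 'I_k.+1) predT) //=.
have h : (\sum_(n < k.+1) \sum_(b | (m b <= k)%N && (inord (m b) == n)) fact (m b + 2) <=
    k.+1 * \sum_(n < k.+1) fact (n + 2))%N.
  rewrite big_distrr /=; apply: leq_sum => n _.
  rewrite (eq_bigr (fun _ => fact (n + 2))); last first.
    by move=> b /andP [hb /eqP <-]; rewrite inordK.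
  rewrite sum_nat_const leq_mul2r; apply/orP; right.
  apply: leq_trans (card_mabs2_le k n); apply: subset_leq_card; apply/subsetP => b.
  by rewrite !inE => /andP [hb /eqP <-]; rewrite inordK.
apply: leq_trans (_ : (2 * (k.+1 * \sum_(n < k.+1) fact (n + 2)) <= _)%N); first by rewrite leq_mul2l.
rewrite mulnCA; apply: leq_trans (_ : (k.+1 * (3 * fact (k + 2)) <= _)%N).
  by rewrite leq_mul2l sum_fact_le orbT.
have -> : fact (k + 3) = ((k + 3) * fact (k + 2))%N by rewrite (addnS k 2) mulSn.
by rewrite mulnCA leq_mul2l /= leq_mul2r; apply/orP; right; rewrite -addn1 leq_add2l.
Qed.

Lemma Ck_norm2_le k (U : pt 2 -> Prop) g N :
  0 <= N ->
  (forall b, (mabs b <= k)%N -> forall x, U x -> Cmod (Dm b g x) <= INR (fact (mabs b + 2)) / 2 * N) ->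
  Rbar_le (Ck_norm k U g) (Rbar.Finite (3 / 4 * INR (fact (k + 3)) * N)).
Proof.
move=> n0 h.
apply: (@Rbar_le_trans _ (Rbar.Finite (N / 2 * INR (\sum_(b : {ffun 'I_2 -> 'I_k.+1} |
  (mabs (fun i => nat_of_ord (b i)) <= k)%N) fact (mabs (fun i => nat_of_ord (b i)) + 2)))));
  last first.
  have /leP/le_INR := sum_fact_mabs2_le k; rewrite !mult_INR -[INR 2]/2.
  rewrite (_ : INR 3 = 3); last by rewrite /=; ring.
  set S := INR _; set T := INR _ => hS; rewrite /Rbar_le.
  have n4 : 0 <= N / 4 by lra.
  by have := Rmult_le_compat_l _ _ _ n4 hS; lra.
apply: (big_ind2 (fun a n => Rbar_le a (Rbar.Finite (N / 2 * INR n)))).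
- by rewrite Rmult_0_r; exact: Rbar_le_refl.
- move=> a n b p ha hb; rewrite plus_INR Rmult_plus_distr_l.
  exact: (Rbar_plus_le_compat _ (Rbar.Finite _) _ (Rbar.Finite _) ha hb).
- move=> b hb.
  apply: supC_le; first by apply: Rmult_le_pos; [lra | exact: pos_INR].
  by move=> x ux; have := h _ hb x ux; lra.
Qed.

(** * Estimates for a single extension *)

Lemma is_partial_comp_phi (U : pt 3 -> Prop) k g l i x :
  is_open_set U -> Ck_mem k U g -> U (phi x) -> (size l < k)%N ->
  is_partial i (fun y => Dsort g l (phi y)) x
    (csum [seq Cmult (RtoC (dphi (j, [:: i]) x)) (Dsort g (j :: l) (phi x)) | j <- [:: ax0; ax1; ax2]]).
Proof.
move=> oU gk ux hl.
have hc j : is_derive (fun t => phi (shift x i t) j) 0 (dphi (j, [:: i]) x).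
  apply: (is_derive_ext (fun t => dphi (j, [::]) (shift x i t))); last exact: is_derive_dphi.
  by move=> t; rewrite phi_dphi.
have e0 : phi (shift x i 0) = phi x by rewrite shift0.
have hb j := box_cont_Dsort (l := j :: l) oU gk hl ux.
split.
- have := @chain_rule3 U (fun y => fst (Dsort g l y)) (fun j y => fst (Dsort g (j :: l) y))
    (fun t => phi (shift x i t)) (fun j => dphi (j, [:: i]) x).
  rewrite e0 => h; have := h (fun j y uy => (is_partial_Dsort oU gk j hl uy).1) (fun j => (hb j).1) hc.
  congr is_derive => /=; ring.
- have := @chain_rule3 U (fun y => snd (Dsort g l y)) (fun j y => snd (Dsort g (j :: l) y))
    (fun t => phi (shift x i t)) (fun j => dphi (j, [:: i]) x).
  rewrite e0 => h; have := h (fun j y uy => (is_partial_Dsort oU gk j hl uy).2) (fun j => (hb j).2) hc.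
  congr is_derive => /=; ring.
Qed.

Lemma dfs_bounds k alpha f fs N :
  0 < alpha < 1 -> is_extension k alpha f fs -> star_norm k alpha fs = Rbar.Finite N ->
  [/\ Ck_mem k (setT_pt 2) (dfs f),
    Rbar_le (holder_semi k alpha (setT_pt 2) (dfs f)) (Rbar.Finite (INR (fact (k + 3)) * N)) &
    Rbar_le (Ck_norm k (setT_pt 2) (dfs f)) (Rbar.Finite (3 / 4 * INR (fact (k + 3)) * N))].
Proof.
move=> a01 [U [oU [sU [[fk _] ff]]]] hN.
have -> : dfs f = fun x => Dsort fs [::] (phi x).
  by apply: functional_extensionality => x; rewrite /dfs -ff //; exact: sphere_phi.
have hb l x : (size l <= k)%N -> Cmod (Dsort fs l (phi x)) <= N.
  move=> hl; suff : Rbar_le (Rbar.Finite (Cmod (Dsort fs l (phi x)))) (Rbar.Finite N) by [].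
  rewrite -hN; apply: Rbar_le_trans (le_supC _ (sphere_phi x)) _.
  apply: Rbar_le_trans (le_Rbar_plusl _ (holder_semi_ge0 _ _ _ _)).
  by rewrite /Dsort -dirs_count; apply: supC_le_Ck_norm; rewrite mabs_count.
have n0 : 0 <= N by apply: Rle_trans (Cmod_ge_0 _) (hb [::] (fun _ => 0) _).
have hh l x y : size l = k -> x <> y ->
    Cmod (Cminus (Dsort fs l (phi x)) (Dsort fs l (phi y))) <= N * Rpower (pdist x y) alpha.
  move=> hl xy; have r0 : 0 < Rpower (pdist x y) alpha by exact: exp_pos.
  (* [phi] is not injective, and the seminorm on the sphere says nothing about coinciding images. *)
  have [->|ne] := classic (phi x = phi y).
    have -> : Cminus (Dsort fs l (phi y)) (Dsort fs l (phi y)) = RtoC 0 by ring.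
    by rewrite Cmod_0; apply: Rmult_le_pos; lra.
  have d0 := pdist_gt0 ne.
  have s0 : 0 < Rpower (pdist (phi x) (phi y)) alpha by exact: exp_pos.
  have : Rbar_le (Rbar.Finite (Cmod (Cminus (Dsort fs l (phi x)) (Dsort fs l (phi y))) /
      Rpower (pdist (phi x) (phi y)) alpha)) (Rbar.Finite N).
    rewrite -hN; apply: Rbar_le_trans (le_Rbar_plusr _ (Ck_norm_ge0 _ _ _)).
    apply: le_Rbar_lub; right; exists (fun i => count_mem i l), (phi x), (phi y).
    rewrite mabs_count /Dm dirs_count; split => //.
    by do 2!(split; first exact: sphere_phi); split.
  move=> /= h; apply: Rle_trans (_ : N * Rpower (pdist (phi x) (phi y)) alpha <= _).
    have -> : Cmod (Cminus (Dsort fs l (phi x)) (Dsort fs l (phi y))) =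
      Cmod (Cminus (Dsort fs l (phi x)) (Dsort fs l (phi y))) /
      Rpower (pdist (phi x) (phi y)) alpha * Rpower (pdist (phi x) (phi y)) alpha by field; lra.
    by apply: Rmult_le_compat_r => //; lra.
  apply: Rmult_le_compat_l => //; apply: Rle_Rpower_l; first lra.
  by split => //; exact: phi_nonexpansive.
have hc l i x (hl : (size l < k)%N) := is_partial_comp_phi i oU fk (sU _ (sphere_phi x)) hl.
have K0 : 0 <= INR (fact (k + 3)) * N by apply: Rmult_le_pos; [exact: pos_INR | ].
split.
- move=> b hbk; have hs : (size (dirs b) <= k)%N by rewrite size_dirs.
  split; first exact: (Dl_expansion hc hs).1.
  split.
    exists (INR (fact (size (dirs b) + 2)) / 2 * N) => x _; exact: Dl_bound hb hc _ _ _.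
  move=> eps eps0; set K := INR (fact (k + 3)) * N in K0.
  (* Chosen so that [(K + 1) * delta ^ alpha = eps]; adding 1 avoids dividing by 0 when [K = 0]. *)
  exists (Rpower (eps / (K + 1)) (/ alpha)); split; first exact: exp_pos.
  move=> x y _ _ hd.
  have q0 : 0 < eps / (K + 1) by apply: Rdiv_lt_0_compat; lra.
  have [->|xy] := classic (x = y).
    by rewrite (_ : Cminus _ _ = RtoC 0) ?Cmod_0 //; ring.
  have d0 := pdist_gt0 xy.
  apply: Rle_lt_trans (Dl_holder a01 hb hh hc hs xy) _; rewrite -/K.
  have hr : Rpower (pdist x y) alpha < eps / (K + 1).
    have -> : eps / (K + 1) = Rpower (Rpower (eps / (K + 1)) (/ alpha)) alpha.
      by rewrite Rpower_mult Rinv_l ?Rpower_1 //; lra.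
    by apply: Rlt_Rpower_l; lra.
  have r0 : 0 < Rpower (pdist x y) alpha by exact: exp_pos.
  have : (K + 1) * Rpower (pdist x y) alpha < (K + 1) * (eps / (K + 1)) by apply: Rmult_lt_compat_l; lra.
  have -> : (K + 1) * (eps / (K + 1)) = eps by field; lra.
  lra.
- apply: Rbar_lub_le => v [->|[b [x [y [hbk [_ [_ [xy ->]]]]]]]] //=.
  have r0 : 0 < Rpower (pdist x y) alpha by exact: exp_pos.
  apply: (Rmult_le_reg_r (Rpower (pdist x y) alpha)) => //.
  rewrite /Rdiv Rmult_assoc Rinv_l ?Rmult_1_r; last lra.
  by apply: (Dl_holder a01 hb hh hc _ xy); rewrite size_dirs hbk.
- apply: Ck_norm2_le => // b hbk x _; rewrite -size_dirs.
  by apply: Dl_bound hb hc _ _ _; rewrite size_dirs.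
Qed.

(** * Passage to the infimum over all extensions *)

(** The bounds say that [X / K] is a lower bound of [E], so it lies below the infimum even if that
    is not attained. *)
Lemma Rbar_le_mult_glb (E : Rbar -> Prop) (X : Rbar) (K S : R) :
  0 < K -> Rbar_glb E = Rbar.Finite S ->
  Rbar_le (Rbar.Finite 0) X -> (exists N, E (Rbar.Finite N)) ->
  (forall v, E v -> Rbar_le (Rbar.Finite 0) v) ->
  (forall N, E (Rbar.Finite N) -> Rbar_le X (Rbar.Finite (K * N))) ->
  Rbar_le X (Rbar_mult (Rbar.Finite K) (Rbar_glb E)).
Proof.
move=> K0 hS X0 [N0 hN0] E0 hE.
have := hE _ hN0; case: X X0 hE => [B||] //= _ hE _.
have h : Rbar_le (Rbar.Finite (B / K)) (Rbar_glb E).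
  apply (Rbar_glb_correct E).2 => v hv.
  have v0 := E0 v hv; case: v v0 hv => [N||] //= _ hv.
  have := hE _ hv => h; apply: (Rmult_le_reg_l K) => //.
  by rewrite (_ : K * (B / K) = B) //; field; lra.
move: h; rewrite hS /= => h.
have := Rmult_le_compat_l K _ _ (Rlt_le _ _ K0) h.
by rewrite (_ : K * (B / K) = B) //; field; lra.
Qed.

Lemma dfs_periodic f x (i : 'I_2) : dfs f (shift x i (2 * PI)) = dfs f x.
Proof.
rewrite /dfs; congr f; apply: functional_extensionality => j.
by have [->|->] := ord2_cases i; rewrite /phi /shift /=; case: (nat_of_ord j) => [|[|n]];
  rewrite ?cos_plus ?sin_plus ?cos_2PI ?sin_2PI; ring.
Qed.

Theorem theorem4p5 (k : nat) (alpha : R) (f : pt 3 -> C) :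
  0 < alpha < 1 ->
  sphere_mem k alpha f ->
  torus_mem k alpha (dfs f) /\
  Rbar_le (holder_semi k alpha (setT_pt 2) (dfs f))
          (Rbar_mult (INR (fact (k + 3)%nat)) (sphere_norm k alpha f)) /\
  Rbar_le (Cka_norm k alpha (setT_pt 2) (dfs f))
          (Rbar_mult (7 / 4 * INR (fact (k + 3)%nat)) (sphere_norm k alpha f)).
Proof.
move=> a01 fm.
pose E v := exists fs, is_extension k alpha f fs /\ v = star_norm k alpha fs.
have E0 v : E v -> Rbar_le (Rbar.Finite 0) v.
  by case=> fs [_ ->]; apply: Rbar_plus_ge0; [exact: Ck_norm_ge0 | exact: holder_semi_ge0].
(* If no extension had a finite norm, all values in [E] would be [p_infty], and so would their
   infimum. *)
have [N hN] : exists N, E (Rbar.Finite N).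
  apply: NNPP => hn.
  have : Rbar_le p_infty (sphere_norm k alpha f).
    apply (Rbar_glb_correct E).2 => v hv.
    by have v0 := E0 v hv; case: v v0 hv => [N||] //= _ hv; case: hn; exists N.
  by move: fm; rewrite /sphere_mem; case: sphere_norm.
have [S hS] : exists S, Rbar_glb E = Rbar.Finite S.
  have : Rbar_le (Rbar.Finite 0) (Rbar_glb E) by apply (Rbar_glb_correct E).2.
  have := (Rbar_glb_correct E).1 _ hN.
  by case: (Rbar_glb E) => [S||] //= _ _; exists S.
have K0 : 0 < INR (fact (k + 3)) by exact: INR_fact_lt_0.
have bnd N' : E (Rbar.Finite N') -> [/\ Ck_mem k (setT_pt 2) (dfs f),
    Rbar_le (holder_semi k alpha (setT_pt 2) (dfs f)) (Rbar.Finite (INR (fact (k + 3)) * N')) &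
    Rbar_le (Ck_norm k (setT_pt 2) (dfs f)) (Rbar.Finite (3 / 4 * INR (fact (k + 3)) * N'))].
  by case=> fs [hfs /esym]; exact: dfs_bounds.
have [ck hol _] := bnd _ hN.
split; [split; [split => //|] | split].
- exact: Rbar_le_lt_trans hol _.
- exact: dfs_periodic.
- apply: (Rbar_le_mult_glb K0 hS _ (ex_intro _ N hN) E0); first exact: holder_semi_ge0.
  by move=> N' /bnd [].
- have K1 : 0 < 7 / 4 * INR (fact (k + 3)) by lra.
  apply: (Rbar_le_mult_glb K1 hS _ (ex_intro _ N hN) E0).
    by apply: Rbar_plus_ge0; [exact: Ck_norm_ge0 | exact: holder_semi_ge0].
  move=> N' /bnd [_ h1 h2].
  (* 7/4 is 3/4 from the sum of suprema plus 1 from the Hoelder seminorm. *)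
  have -> : 7 / 4 * INR (fact (k + 3)) * N' =
    3 / 4 * INR (fact (k + 3)) * N' + INR (fact (k + 3)) * N' by field.
  exact: (Rbar_plus_le_compat _ (Rbar.Finite _) _ (Rbar.Finite _) h2 h1).
Qed.
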